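(* Let $\rho\in(0,1)$ (unknown) and $\alpha\in(0,1)$, and let $X_1,X_2,\dots$ be jointly Gaussian with $X_i\sim N(\mu_i,1)$, $\mu_i\ge0$, and $\operatorname{Corr}(X_i,X_j)=\rho$ for all $i\neq j$. For each $n\ge2$ let $\mathcal I_0=\{i\le n:\mu_i=0\}$, $n_1=n-|\mathcal I_0|$, $m=\lfloor n/2\rfloor$, $$\hat\rho_n^{\star}=\max\Big\{0,\ \frac1m\sum_{i=1}^m\Big(1-\frac{(X_{2i-1}-X_{2i})^2}{2}\Big)\Big\},\qquad c_n(\alpha,\hat\rho_n^\star)=\sqrt{1-\hat\rho_n^\star}\,\Phi^{-1}\!\left(1-\tfrac1n\right)-\sqrt{\hat\rho_n^\star}\,\Phi^{-1}(\alpha).$$ If $\dfrac{\log n\cdot n_1\cdot\sup_{1\le i\le n}\mu_i^2}{n}\to0$ as $n\to\infty$, then the procedure that rejects $\mathrm{H}_{0i}$ whenever $X_i>c_n(\alpha,\hat\rho_n^\star)$ is asymptotically exact: $$\lim_{n\to\infty}\mathrm{FWER}^{II}(n,\alpha,\rho)=\lim_{n\to\infty}\mathbb{P}\left(\bigcup_{i\in\mathcal I_0}\{X_i>c_n(\alpha,\hat\rho_n^\star)\}\right)=\alpha.$$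
   Context: $\Phi$ is the standard normal distribution function. For each $n$ one tests $\mathrm{H}_{0i}:\mu_i=0$ versus $\mathrm{H}_{1i}:\mu_i>0$, $i=1,\dots,n$; $\mathcal I_0$ (depending on $n$) is the index set of true nulls. $\mathrm{FWER}^{II}(n,\alpha,\rho)$ is the family-wise error rate of the stated procedure, i.e. the probability that it rejects at least one true null hypothesis. The means $\mu_i$ do not depend on $n$. *)

(* Defs.v *)
From HB Require Import structures.
From mathcomp Require Import all_boot all_order all_algebra.
From mathcomp Require Import all_classical all_reals all_analysis.

Set Implicit Arguments.
Unset Strict Implicit.
Unset Printing Implicit Defensive.
Import Order.TTheory GRing.Theory Num.Theory.
Import numFieldNormedType.Exports.
Local Open Scope classical_set_scope.
Local Open Scope ring_scope.

(* Random variables, means and hypotheses are indexed from 0: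
   X i, mu i below are $X_{i+1}$, $\mu_{i+1}$. *)

Definition Phi {R : realType} (x : R) : R := fine (normal_prob 0 1 `]-oo, x]).

(* Only its values on `]0, 1[, the range of Phi, are meaningful. *)
Definition Phi_inv {R : realType} : R -> R := 'pinv_(fun=> 0) setT (@Phi R).

(* N(m, s^2), with N(m, 0) the Dirac mass at m: [normal_prob m 0] is instead
   the uniform distribution on [0, 1]. *)
Definition normal_law {R : realType} (m s : R) : set R -> \bar R :=
  if s == 0 then fun A => \d_m A else normal_prob m s.

(* Equality on measurable sets only, since measures are total functions. *)
Definition has_law {d : measure_display} {T : measurableType d} {R : realType}
    (P : probability T R) (X : {RV P >-> R}) (nu : set R -> \bar R) : Prop :=
  forall A : set R, measurable A -> distribution P X A = nu A.
Arguments has_law {d T R} P X nu.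

Definition jointly_gaussian {d : measure_display} {T : measurableType d}
    {R : realType} (P : probability T R) (X : nat -> {RV P >-> R}) : Prop :=
  forall (n : nat) (a : 'I_n -> R), exists m s : R,
    0 <= s /\
    has_law P (\sum_(i < n) a i *: (X i : {mfun T >-> R})) (normal_law m s).
Arguments jointly_gaussian {d T R} P X.

Definition correlation {d : measure_display} {T : measurableType d}
    {R : realType} (P : probability T R) (X Y : {RV P >-> R}) : R :=
  fine (covariance P X Y) /
  (Num.sqrt (fine ('V_P[X])) * Num.sqrt (fine ('V_P[Y]))).
Arguments correlation {d T R} P X Y.

Definition true_nulls {R : realType} (mu : nat -> R) (n : nat) : {set 'I_n} :=
  [set i : 'I_n | mu i == 0]%SET.

Definition n_false_nulls {R : realType} (mu : nat -> R) (n : nat) : nat :=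
  (n - #|true_nulls mu n|)%N.

Definition rho_hat {T : Type} {R : realType} (X : nat -> T -> R) (n : nat)
    (w : T) : R :=
  Num.max 0 ((n./2)%:R^-1 *
    \sum_(i < n./2) (1 - (X i.*2 w - X i.*2.+1 w) ^+ 2 / 2)).

Definition cutoff {R : realType} (n : nat) (alpha r : R) : R :=
  Num.sqrt (1 - r) * Phi_inv (1 - n%:R^-1) - Num.sqrt r * Phi_inv alpha.

(* [rejects X alpha n i] is the event that the i-th null is rejected. *)
Definition rejects {T : Type} {R : realType} (X : nat -> T -> R) (alpha : R)
    (n : nat) (i : 'I_n) : set T :=
  [set w | X i w > cutoff n alpha (rho_hat X n w)].
Arguments rejects {T R} X alpha n i.

Definition FWER {d : measure_display} {T : measurableType d} {R : realType}
    (P : probability T R) (mu : nat -> R) (n : nat)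
    (reject : 'I_n -> set T) : \bar R :=
  P [set w | exists2 i : 'I_n, i \in true_nulls mu n & reject i w].
Arguments FWER {d T R} P mu n reject.

(* Main.v *)
(* For fixed n the Gaussian vector splits exactly as
     X_i = mu_i + sqrt (1 - rho) U_i + tau_n Z,  i < n,
   with Z standard normal and the U_i standard normal and pairwise independent;
   Z is the normalized sum of the X_i - mu_i and tau_n tends to sqrt rho.
   Let b_n = Phi_inv (1 - 1/n). Over the true nulls the maximum of the U_i is at
   most b_n + e with high probability by a union bound, and at least b_n - e by
   a second moment argument, for which pairwise independence is enough. The
   sparsity condition makes b_n |rho_hat - rho| small in probability, so up to
   small errors some true null is rejected iff Z > - Phi_inv alpha, which has
   probability alpha. *)

Require Import Defs.
From HB Require Import structures.
From mathcomp Require Import all_boot all_order all_algebra.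
From mathcomp Require Import all_classical all_reals all_analysis.
From mathcomp Require Import measurable_realfun ring lra.

Set Implicit Arguments.
Unset Strict Implicit.
Unset Printing Implicit Defensive.
Import Order.TTheory GRing.Theory Num.Theory.
Import numFieldNormedType.Exports.
Local Open Scope classical_set_scope.
Local Open Scope ring_scope.

(** * Gaussian integrals *)

(** Joint Gaussianity is given only through the laws of linear combinations. Expectations of
    products of functions of U_i and U_j come from cosines: a product of two cosines is a sum of
    cosines of linear combinations, and Gaussian bumps are mixtures of cosines. The second moment
    argument therefore sums not indicators of exceedances but likelihood ratios of N(a, 1 / (1 + k))
    against N(0, 1): these are multiples of bumps, have explicit moments, and avoid lower bounds on
    Gaussian tails. A pure shift, k = 0, has second moment exp(a^2), too large against n terms; k =
    b_n^2 reduces the exponent to a^2 / 2 plus a bounded term, and exp(b_n^2 / 2) <= n by the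
    Chernoff bound. Taking a = b_n - e / 2 gains exp(- b_n e / 2), which beats the polynomial
    prefactor. Z is n^(-1/2) times the sum of the U_i, hence not independent of them: exceptional
    events are removed by union bounds, so that only the law of Z itself matters. The bias of the
    untruncated estimator is at most of order n_1 sup mu_i^2 / n, and the log n of the sparsity
    condition absorbs b_n^2 <= 2 log n. *)

Lemma ge0_integral_normal_prob (R : realType) (m s : R) (g : R -> \bar R) :
  measurable_fun setT g -> (forall x, 0 <= g x)%E ->
  (\int[normal_prob m s]_x g x =
   \int[lebesgue_measure]_x (g x * (normal_pdf m s x)%:E))%E.
Proof.
move=> mg g0.
have dom := @normal_prob_dominates R m s.
rewrite -(Radon_Nikodym_SigmaFinite.change_of_variables dom)//.
have intRN := Radon_Nikodym_SigmaFinite.f_integrable dom.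
have mp : measurable_fun setT (EFin \o normal_pdf m s).
  by apply/measurable_EFinP; exact: measurable_normal_pdf.
apply: ae_eq_integral => //.
- by apply: emeasurable_funM => //; exact: measurable_int intRN.
- exact: emeasurable_funM.
(* The Radon-Nikodym derivative and the density have the same integral over every measurable set,
   hence agree almost everywhere. *)
- apply: ae_eqe_mul2l.
  apply: integral_ae_eq => // E _ mE.
  by rewrite -Radon_Nikodym_SigmaFinite.f_integral.
Qed.

(** The scaled pushforward gives every half-open interval its length, and this characterizes
    Lebesgue measure. *)
Lemma lebesgue_measure_affine (R : realType) (m s : R) (A : set R) :
  0 < s -> measurable A ->
  (lebesgue_measure A =
    s%:E * lebesgue_measure ((fun x => m + s * x)%R @^-1` A))%E.
Proof.
move=> s0 mA; have s0' : 0 <= s by exact: ltW.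
have mf : measurable_fun setT (fun x : measurableTypeR R => (m + s * x : measurableTypeR R)).
  by apply: measurable_funD => //; exact: measurable_funM.
pose nu : {measure set (measurableTypeR R) -> \bar R} := mscale (NngNum s0')
  (measure_function_pushforward__canonical__measure_function_Measure
    (@lebesgue_measure R) mf).
rewrite (@lebesgue_measure_unique R nu)//.
move=> _ [[a b]] _ <-.
rewrite /nu /= /mscale/= /pushforward/=.
rewrite (_ : _ @^-1` _ = `](a - m) / s, (b - m) / s]%classic); last first.
  apply/seteqP; split => x /=; rewrite !in_itv/= ltr_pdivrMr// ler_pdivlMr//;
    by rewrite ltrBlDl lerBrDl (mulrC x).
rewrite !lebesgue_measure_itv/= !lte_fin ltr_pM2r ?invr_gt0// ltrD2r.
case: ifPn => ab; last by rewrite mule0.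
by rewrite -!EFinB -EFinM; congr EFin; field; exact: lt0r_neq0.
Qed.

Lemma normal_prob_affine (R : realType) (m s : R) (A : set R) :
  0 < s -> measurable A ->
  normal_prob m s A = normal_prob 0 1 ((fun x => m + s * x) @^-1` A).
Proof.
move=> s0 mA; have s0' : 0 <= s by exact: ltW.
have mf : measurable_fun setT (fun x : measurableTypeR R => (m + s * x : measurableTypeR R)).
  by apply: measurable_funD => //; exact: measurable_funM.
have mfA : measurable ((fun x : measurableTypeR R => (m + s * x : measurableTypeR R)) @^-1` A).
  by rewrite -[X in measurable X]setTI; exact: mf.
pose push := measure_function_pushforward__canonical__measure_function_Measure
    (@lebesgue_measure R) mf.
have mp : measurable_fun setT (EFin \o normal_pdf m s).
  by apply/measurable_EFinP; exact: measurable_normal_pdf.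
rewrite /normal_prob.
rewrite (@eq_measure_integral _ (measurableTypeR R) R A (mscale (NngNum s0') push)); last first.
  by move=> B mB _; exact: lebesgue_measure_affine.
rewrite ge0_integral_mscale//=; last first.
- by move=> x _; rewrite lee_fin normal_pdf_ge0.
- exact: measurable_funTS.
rewrite ge0_integral_pushforward//=; last first.
- by move=> x _; rewrite lee_fin normal_pdf_ge0.
- exact: measurable_funTS.
rewrite -ge0_integralZl//=; last first.
- by move=> x _; rewrite lee_fin normal_pdf_ge0.
- apply: measurable_funTS; apply: (measurableT_comp mp) => //.
apply: eq_integral => x _; rewrite -EFinM !normal_pdfE ?gt_eqF//.
rewrite /normal_peak /normal_fun !subr0 !expr1n !mul1r mulrA; congr (_ * expR _)%:E.
  rewrite -mulrnAr sqrtrM ?sqr_ge0// sqrtr_sqr gtr0_norm// invfM mulrA divff ?gt_eqF//.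
  by rewrite mul1r.
rewrite (addrC m) addrK; field; by rewrite gt_eqF.
Qed.

(** Covers [s = 0] as well, where both sides are a Dirac mass, so that linear combinations of
    unknown variance need no case distinction later. *)
Lemma normal_law_affine (R : realType) (m s : R) (A : set R) :
  0 <= s -> measurable A ->
  normal_law m s A = normal_prob 0 1 ((fun x => m + s * x) @^-1` A).
Proof.
rewrite /normal_law => s0 mA; case: ifPn => [/eqP ->|sN0]; last first.
  by rewrite normal_prob_affine// lt_neqAle eq_sym sN0.
rewrite diracE; have [mA1|mA1] := boolP (m \in A).
  rewrite (_ : _ @^-1` _ = setT) ?probability_setT//.
  by apply/seteqP; split => x //= _; rewrite mul0r addr0; exact: set_mem.
rewrite (_ : _ @^-1` _ = set0) ?measure0//.
apply/seteqP; split => x //=; rewrite mul0r addr0 => /mem_set; exact/negP.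
Qed.

(* N(0, s^2) as the image of N(0, 1) under x |-> s x, so that s = 0 is allowed. *)
Definition gaussian {d : measure_display} {T : measurableType d} {R : realType}
    (P : probability T R) (U : T -> R) (s : R) : Prop :=
  measurable_fun setT U /\
  forall A : set R, measurable A ->
    P (U @^-1` A) = normal_prob 0 1 ((fun x => s * x) @^-1` A).

Section gaussian_integrals.
Context {d : measure_display} {T : measurableType d} {R : realType}.
Variables (P : probability T R) (U : T -> R) (s : R).
Hypothesis gU : gaussian P U s.

Let ms : measurable_fun setT (fun x : R => (s * x : R)).
Proof. exact: measurable_funM. Qed.

Lemma ge0_integral_gaussian (g : R -> R) :
  measurable_fun setT g -> (forall x, 0 <= g x) ->
  (\int[P]_w (g (U w))%:E = \int[normal_prob 0 1]_x (g (s * x))%:E)%E.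
Proof.
move=> mg g0; have mg' : measurable_fun setT (EFin \o g) by exact/measurable_EFinP.
rewrite -(@ge0_integral_pushforward _ _ _ _ _ _ gU.1 P setT (EFin \o g))//=; last first.
  by move=> x _; rewrite lee_fin.
have -> := @eq_measure_integral _ _ _ setT
  (measure_function_pushforward__canonical__measure_function_Measure (@normal_prob R 0 1) ms)
  (measure_function_pushforward__canonical__measure_function_Measure P gU.1) (EFin \o g).
  by rewrite ge0_integral_pushforward//= => x _; rewrite lee_fin.
by move=> A mA _; exact: (gU.2 A mA).
Qed.

Lemma integrable_gaussian (g : R -> R) : measurable_fun setT g ->
  (@normal_prob R 0 1).-integrable setT (EFin \o (fun x => g (s * x))) ->
  P.-integrable setT (EFin \o (fun w => g (U w))).
Proof.
move=> mg ig; apply/integrableP; split.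
  by apply/measurable_EFinP; exact: measurableT_comp mg gU.1.
rewrite (@ge0_integral_gaussian (fun x => `|g x|))//.
  by move/integrableP : ig => [].
exact: measurableT_comp.
Qed.

Lemma Rintegral_gaussian (g : R -> R) : measurable_fun setT g ->
  (@normal_prob R 0 1).-integrable setT (EFin \o (fun x => g (s * x))) ->
  \int[P]_w g (U w) = \int[normal_prob 0 1]_x g (s * x).
Proof.
move=> mg ig; have mg' : measurable_fun setT (EFin \o g) by exact/measurable_EFinP.
have ig' := integrable_gaussian mg ig.
congr fine.
rewrite -(@integral_pushforward _ _ _ _ _ _ gU.1 P setT (EFin \o g))//=.
have -> := @eq_measure_integral _ _ _ setT
  (measure_function_pushforward__canonical__measure_function_Measure (@normal_prob R 0 1) ms)
  (measure_function_pushforward__canonical__measure_function_Measure P gU.1) (EFin \o g).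
  by rewrite integral_pushforward.
by move=> A mA _; exact: (gU.2 A mA).
Qed.

End gaussian_integrals.

Lemma ge0_integral_normal_affine (R : realType) (m s : R) (g : R -> R) :
  0 < s -> measurable_fun setT g -> (forall x, 0 <= g x) ->
  (\int[normal_prob m s]_x (g x)%:E =
   \int[normal_prob 0 1]_x (g (m + s * x))%:E)%E.
Proof.
move=> s0 mg g0; have mg' : measurable_fun setT (EFin \o g) by exact/measurable_EFinP.
have mf : measurable_fun setT (fun x : measurableTypeR R => (m + s * x : measurableTypeR R)).
  by apply: measurable_funD => //; exact: measurable_funM.
have -> := @eq_measure_integral _ (measurableTypeR R) R setT
  (measure_function_pushforward__canonical__measure_function_Measure (@normal_prob R 0 1) mf)
  (@normal_prob R m s) (EFin \o g).
  by rewrite ge0_integral_pushforward//= => x _; rewrite lee_fin.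
by move=> A mA _; exact: normal_prob_affine.
Qed.

(** The expectation of exp(l Z - k Z^2 / 2) for Z standard normal. *)
Definition tilt_mass {R : realType} (l k : R) : R :=
  expR (l ^+ 2 / (2 * (1 + k))) / Num.sqrt (1 + k).

(** The algebra of completing the square, with [p] and [q] in place of the square roots of 2 pi and
    1 + k, so that [field] meets no square root. *)
Fact tilt_density (R : realType) (l k x y p q : R) :
  1 + k != 0 -> p != 0 -> q != 0 ->
  expR (l * x - k * x ^+ 2 / 2) * y * (p^-1 * expR (- x ^+ 2 / 2)) =
  expR (l ^+ 2 / (2 * (1 + k))) / q *
    (y * ((q^-1 * p)^-1 * expR (- (x - l / (1 + k)) ^+ 2 / ((1 + k)^-1 *+ 2)))).
Proof.
move=> k1 p0 q0.
transitivity (y / p * expR (l * x - k * x ^+ 2 / 2 + - x ^+ 2 / 2)).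
  by rewrite (expRD (l * x - k * x ^+ 2 / 2)); ring.
transitivity (y / p * expR (l ^+ 2 / (2 * (1 + k)) +
    - (x - l / (1 + k)) ^+ 2 / ((1 + k)^-1 *+ 2))); last first.
  rewrite (expRD (l ^+ 2 / (2 * (1 + k)))); move: (expR _) (expR _) => A B.
  by rewrite invfM invrK; field; rewrite ?p0 ?q0.
by congr (_ * expR _); field.
Qed.

(* Completing the square: the weight exp(l x - k x^2 / 2) turns N(0, 1) into
   a multiple of N(l / (1 + k), 1 / (1 + k)). *)
Lemma ge0_integral_tilt (R : realType) (l k : R) (h : R -> R) :
  0 <= k -> measurable_fun setT h -> (forall x, 0 <= h x) ->
  (\int[normal_prob 0 1]_x (expR (l * x - k * x ^+ 2 / 2) * h x)%:E =
   (tilt_mass l k)%:E *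
   \int[normal_prob 0 1]_x (h (l / (1 + k) + (Num.sqrt (1 + k))^-1 * x))%:E)%E.
Proof.
move=> k0 mh h0; have k1 : 0 < 1 + k by rewrite ltr_wpDr.
have sk0 : 0 < Num.sqrt (1 + k) by rewrite sqrtr_gt0.
have me : measurable_fun setT (fun x : R => expR (l * x - k * x ^+ 2 / 2)).
  apply: measurableT_comp => //; apply: measurable_funB; first exact: measurable_funM.
  by apply: measurable_funM => //; apply: measurable_funM => //; exact: measurable_funX.
have meh : measurable_fun setT (fun x : R => expR (l * x - k * x ^+ 2 / 2) * h x).
  exact: measurable_funM.
rewrite ge0_integral_normal_prob//=; last first.
- by move=> x; rewrite lee_fin mulr_ge0 ?expR_ge0.
- exact/measurable_EFinP.
rewrite -ge0_integral_normal_affine ?invr_gt0// ge0_integral_normal_prob//=; last first.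
- exact/measurable_EFinP.
rewrite -ge0_integralZl//=; last first.
- by rewrite lee_fin mulr_ge0 ?expR_ge0 // invr_ge0 ltW.
- by move=> x _; rewrite -EFinM lee_fin mulr_ge0 ?normal_pdf_ge0.
- by apply/measurable_EFinP; apply: measurable_funM => //; exact: measurable_normal_pdf.
apply: eq_integral => x _; rewrite -!EFinM; congr EFin.
rewrite !normal_pdfE ?gt_eqF ?invr_gt0//.
rewrite /normal_peak /normal_fun /tilt_mass expr1n mul1r subr0.
rewrite -(mulrnAr ((_)^-1 ^+ 2)) sqrtrM ?sqr_ge0// sqrtr_sqr gtr0_norm ?invr_gt0//.
have q2 : Num.sqrt (1 + k) ^+ 2 = 1 + k by rewrite sqr_sqrtr ?ltW.
rewrite exprVn q2.
apply: tilt_density => //; rewrite ?gt_eqF//.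
by rewrite sqrtr_gt0 mulrn_wgt0// pi_gt0.
Qed.

Lemma integrable_normal_density (R : realType) (m s : R) (g : R -> R) :
  measurable_fun setT g -> (normal_prob m s).-integrable setT (EFin \o g) ->
  (@lebesgue_measure R).-integrable setT (fun x => (g x * normal_pdf m s x)%:E).
Proof.
move=> mg ig.
have mgp : measurable_fun setT (fun x : R => g x * normal_pdf m s x).
  by apply: measurable_funM => //; exact: measurable_normal_pdf.
apply/integrableP; split; first exact/measurable_EFinP.
move/integrableP : ig => [_]; rewrite ge0_integral_normal_prob//=; last first.
  by apply/measurable_EFinP; exact: measurableT_comp.
apply: le_lt_trans; rewrite le_eqVlt; apply/orP; left; apply/eqP.
by apply: eq_integral => x _; rewrite -EFinM normrM (ger0_norm (normal_pdf_ge0 _ _ _)).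
Qed.

Lemma integral_normal_density (R : realType) (m s : R) (g : R -> R) :
  measurable_fun setT g ->
  (\int[normal_prob m s]_x (g x)%:E =
   \int[lebesgue_measure]_x (g x * normal_pdf m s x)%:E)%E.
Proof.
move=> mg; have mg' : measurable_fun setT (EFin \o g) by exact/measurable_EFinP.
have p0 x := @normal_pdf_ge0 R m s x.
rewrite integralE [RHS]integralE; congr (_ - _)%E.
  rewrite ge0_integral_normal_prob//; last exact: measurable_funepos.
  apply: eq_integral => x _; rewrite unlock -!EFin_max -EFinM; congr EFin.
  by rewrite -[in RHS](mul0r (normal_pdf m s x)) maxr_pMl.
rewrite ge0_integral_normal_prob//; last exact: measurable_funeneg.
apply: eq_integral => x _; rewrite unlock -!EFinN -!EFin_max -EFinM; congr EFin.
by rewrite -[in RHS](mul0r (normal_pdf m s x)) maxr_pMl// mulNr.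
Qed.

Lemma normal_pdf01 (R : realType) : @normal_pdf R 0 1 =
  (fun x => normal_peak 1 * expR (- x ^+ 2 / 2)).
Proof.
rewrite normal_pdfE ?oner_eq0//; apply/funext => x.
by rewrite /normal_fun subr0 expr1n.
Qed.

Lemma is_derive_normal_pdf01 (R : realType) (x : R) :
  is_derive x 1 (@normal_pdf R 0 1) (- x * normal_pdf 0 1 x).
Proof.
rewrite normal_pdf01; apply: is_derive_eq.
by rewrite /GRing.scale/=; field.
Qed.

(** * Integrability of real-valued functions *)

Notation intble mu f := (mu.-integrable setT (EFin \o f)).

Section intble_theory.
Context {d : measure_display} {T : measurableType d} {R : realType}.
Variable mu : {measure set T -> \bar R}.
Implicit Types f g : T -> R.

Lemma intble_measurable f : intble mu f -> measurable_fun setT f.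
Proof. by move=> /integrableP[mf _]; exact/measurable_EFinP. Qed.

Lemma intbleD f g : intble mu f -> intble mu g -> intble mu (fun x => f x + g x).
Proof.
by move=> intf intg; apply: eq_integrable (integrableD measurableT intf intg).
Qed.

Lemma intbleB f g : intble mu f -> intble mu g -> intble mu (fun x => f x - g x).
Proof.
by move=> intf intg; apply: eq_integrable (integrableB measurableT intf intg).
Qed.

Lemma intbleZ (c : R) f : intble mu f -> intble mu (fun x => c * f x).
Proof.
by move=> intf; apply: eq_integrable (integrableZl measurableT c intf).
Qed.

Lemma intble_le f g : measurable_fun setT f -> intble mu g ->
  (forall x, `|f x| <= g x) -> intble mu f.
Proof.
move=> mf intg fg; apply: le_integrable intg => //; first exact/measurable_EFinP.
by move=> x _; rewrite /= lee_fin (le_trans (fg x))// ler_norm.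
Qed.

Lemma intble_sum (I : Type) (s : seq I) (Q : pred I) (F : I -> T -> R) :
  (forall i, Q i -> intble mu (F i)) -> intble mu (fun x => \sum_(i <- s | Q i) F i x).
Proof.
move=> intF; elim: s => [|i s IH].
  apply: (eq_integrable measurableT (cst 0%E)); last exact: integrable0.
  by move=> x _; rewrite /= big_nil.
have [Qi|Qi] := boolP (Q i); last first.
  by apply: eq_integrable IH => // x _; rewrite /= big_cons (negbTE Qi).
apply: eq_integrable (intbleD (intF i Qi) IH) => // x _.
by rewrite /= big_cons Qi.
Qed.

(* Cauchy-Schwarz in its weak form |f g| <= (f^2 + g^2) / 2 <= f^2 + g^2. *)
Lemma intbleM f g : measurable_fun setT f -> measurable_fun setT g ->
  intble mu (fun x => f x ^+ 2) -> intble mu (fun x => g x ^+ 2) ->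
  intble mu (fun x => f x * g x).
Proof.
move=> mf mg intf intg; apply: (intble_le _ (intbleD intf intg)).
  exact: measurable_funM.
move=> x; rewrite normrM -(real_normK (num_real (f x))) -(real_normK (num_real (g x))).
by have := normr_ge0 (f x); have := normr_ge0 (g x); nra.
Qed.

Lemma Rintegral_sum (I : Type) (s : seq I) (Q : pred I) (F : I -> T -> R) :
  (forall i, Q i -> intble mu (F i)) ->
  \int[mu]_x (\sum_(i <- s | Q i) F i x) = \sum_(i <- s | Q i) \int[mu]_x F i x.
Proof.
move=> intF; elim: s => [|i s IH].
  rewrite big_nil -[RHS](@Rintegral_set0 _ _ _ mu (cst 0)).
  under eq_Rintegral do rewrite big_nil.
  by rewrite Rintegral_set0 Rintegral_cst// mul0r.
have [Qi|Qi] := boolP (Q i); last first.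
  by under eq_Rintegral do rewrite big_cons (negbTE Qi); rewrite IH big_cons (negbTE Qi).
under eq_Rintegral do rewrite big_cons Qi.
by rewrite RintegralD//; [rewrite IH big_cons Qi|exact: intF|exact: intble_sum].
Qed.

End intble_theory.

Lemma intble_cst {d : measure_display} {T : measurableType d} {R : realType}
  (P : probability T R) (c : R) : intble P (fun=> c).
Proof. exact: finite_measure_integrable_cst. Qed.

Lemma intble_bounded {d : measure_display} {T : measurableType d} {R : realType}
  (P : probability T R) (f : T -> R) (c : R) :
  measurable_fun setT f -> (forall x, `|f x| <= c) -> intble P f.
Proof. by move=> mf fc; apply: intble_le mf (intble_cst P c) fc. Qed.

(** Integration by parts: g' - x g, times the normal density, is the derivative of g times the
    density. The fundamental theorem of calculus on [-n, n] and dominated convergence give the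
    integral over the line, and the last hypothesis makes the boundary terms O(1 / n). *)
Lemma stein (R : realType) (g g' : R -> R) (C : R) :
  (forall x : R, is_derive x (1 : R) g (g' x)) -> continuous g' ->
  (@normal_prob R 0 1).-integrable setT (EFin \o (fun x => x * g x)) ->
  (@normal_prob R 0 1).-integrable setT (EFin \o g') ->
  (forall x, `|g x * normal_pdf 0 1 x| <= C / (1 + `|x|)) ->
  \int[normal_prob 0 1]_x (x * g x) = \int[normal_prob 0 1]_x g' x.
Proof.
move=> dg cg' ixg ig' gC.
have cg : continuous g.
  by move=> x; apply: differentiable_continuous; apply/derivable1_diffP; apply: ex_derive; exact: dg.
have cp := @continuous_normal_pdf R 0 1 (oner_neq0 _).
pose H x := g x * normal_pdf 0 1 x.
pose h x := (g' x - x * g x) * normal_pdf 0 1 x.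
have dH (x : R) : is_derive x 1 H (h x).
  have := dg x; have := is_derive_normal_pdf01 x => dp dgx.
  by apply: is_derive_eq; rewrite /GRing.scale/= /h; ring.
have ch : continuous h.
  move=> x; apply: cvgM; last exact: cp.
  apply: cvgB; first exact: cg'.
  by apply: cvgM; [exact: cvg_id|exact: cg].
have mh : measurable_fun setT h by exact: continuous_measurable_fun.
have mg'g : measurable_fun setT (fun x => g' x - x * g x).
  apply: continuous_measurable_fun => x; apply: cvgB; first exact: cg'.
  by apply: cvgM; [exact: cvg_id|exact: cg].
have ig'g := intbleB ig' ixg.
have ih := integrable_normal_density mg'g ig'g.
have mitv (n : nat) : measurable (`[(- n%:R)%R, n%:R]%classic : set R) by [].
pose hn (n : nat) : R -> \bar R := (EFin \o h) \_ (`[(- n%:R)%R, n%:R]%classic).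
have FTC (n : nat) : (\int[lebesgue_measure]_x hn n x = (H n%:R - H (- n%:R))%:E)%E.
  rewrite /hn -integral_mkcond.
  have [->|n0] := eqVneq n 0%N.
    by rewrite oppr0 set_itv1 integral_set1 subrr.
  rewrite (@continuous_FTC2 _ h H) ?EFinB//.
  - by rewrite gtrN// ltr0n lt0n.
  - exact: continuous_subspaceT.
  - split; first by move=> x _; exact: ex_derive.
    + apply: cvg_at_right_filter; apply: differentiable_continuous.
      by apply/derivable1_diffP; exact: ex_derive.
    + apply: cvg_at_left_filter; apply: differentiable_continuous.
      by apply/derivable1_diffP; exact: ex_derive.
  - by move=> x _; rewrite derive1E; exact: derive_val.
have H0 : (H n%:R - H (- n%:R))%:E @[n --> \oo] --> (0 : \bar R)%E.
  apply/cvg_EFin; first exact: nearW.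
  apply/norm_cvg0P.
  apply: (@squeeze_cvgr _ _ _ _ (cst 0) (fun n => (2 * C) * (n.+1%:R)^-1)).
  - apply: nearW => n /=; rewrite normr_ge0/=.
    apply: (le_trans (ler_normB _ _)).
    rewrite (le_trans (lerD (gC _) (gC _)))// normrN ger0_norm// -mulrDl nat1r mulr_natl.
    by rewrite mulr2n.
  - exact: cvg_cst.
  - by rewrite -[X in _ --> X](mulr0 (2 * C)); apply: cvgMr; exact: cvg_harmonic.
have mhn n : measurable_fun setT (hn n).
  by apply/(measurable_restrictT _ (mitv n)); apply: measurable_funTS; exact/measurable_EFinP.
have hcv x : hn ^~ x @ \oo --> (h x)%:E.
  apply: cvg_near_cst; exists (Num.truncn `|x|).+1 => // n /= xn.
  rewrite /hn patchE mem_set//= in_itv/= -ler_norml.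
  by rewrite (le_trans (ltW (truncnS_gt _)))// ler_nat.
have hle n x : (`|hn n x| <= `|(h x)%:E|)%E.
  by rewrite /hn patchE; case: ifP => // _; rewrite abse0.
have iah : (@lebesgue_measure R).-integrable setT (fun x => `|(h x)%:E|%E).
  exact: integrable_abse.
have aecv : {ae @lebesgue_measure R, forall x : measurableTypeR R,
    setT x -> hn ^~ x @ \oo --> (EFin \o h) x} by exact: aeW.
have aele : {ae @lebesgue_measure R, forall (x : measurableTypeR R) n,
    setT x -> `|hn n x| <= `|(h x)%:E|}%E by apply: aeW => x n _; exact: hle.
have [_ _ cvI] := @dominated_convergence _ (measurableTypeR R) R (@lebesgue_measure R)
  setT measurableT hn (EFin \o h) _ mhn (measurable_int _ ih) aecv iah aele.
have E0 : (\int[lebesgue_measure]_x (h x)%:E = 0)%E.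
  rewrite -(cvg_lim (@ereal_hausdorff R) cvI)//.
  by apply: cvg_lim => //; under eq_fun do rewrite FTC.
apply/esym/eqP; rewrite -subr_eq0 -RintegralB//.
by rewrite /Rintegral integral_normal_density// -/h E0.
Qed.

(** * Gaussian moments and the characteristic function *)

Lemma Rintegral_prob_cst {d : measure_display} {T : measurableType d} {R : realType}
  (P : probability T R) (c : R) : \int[P]_x c = c.
Proof. by rewrite Rintegral_cst//= probability_setT mulr1. Qed.

Lemma ge0_integral_gaussian_expR (R : realType) (l : R) :
  (\int[normal_prob 0 1]_x (expR (l * x))%:E = (expR (l ^+ 2 / 2))%:E)%E.
Proof.
have := @ge0_integral_tilt R l 0 (cst 1) (lexx _) (measurable_cst _) (fun=> ler01).
rewrite /tilt_mass addr0 mulr1 sqrtr1 divr1/= integral_cst// mul1e.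
rewrite [X in (_ * X)%E](_ : _ = 1%E); last exact: probability_setT.
rewrite mule1 => <-; by apply: eq_integral => x _; rewrite /= !mul0r subr0 mulr1.
Qed.

Lemma intble_expR (R : realType) (l : R) : intble (@normal_prob R 0 1) (fun x => expR (l * x)).
Proof.
apply/integrableP; split.
  apply/measurable_EFinP; apply: measurableT_comp => //; exact: measurable_funM.
under eq_integral do rewrite /= ger0_norm ?expR_ge0//.
by rewrite /= ge0_integral_gaussian_expR ltry.
Qed.

Lemma expR_ge_quartic (R : realType) (x : R) : 0 <= x -> x ^+ 4 <= 24 * expR x.
Proof.
move=> x0; have := @expR_ge1Dxn R x 3 x0; rewrite (_ : 4`! = 24%N)// => h.
by rewrite mulrC -ler_pdivrMr//; apply: le_trans h; rewrite lerDr.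
Qed.

Fact exprD1_4_le (R : realType) (y : R) : 0 <= y -> (1 + y) ^+ 4 <= 8 * (1 + y ^+ 4).
Proof.
move=> y0; rewrite -subr_ge0.
(* Equality holds at y = 1, so the difference has the double factor (y - 1)^2. *)
rewrite [leRHS](_ : _ = (y - 1) ^+ 2 * (7 * y ^+ 2 + 10 * y + 7)); last by ring.
by rewrite mulr_ge0 ?sqr_ge0//; nra.
Qed.

(** The common dominating function for all polynomials of degree at most four. In the bound, 8 is
    the constant of [exprD1_4_le] and 192 = 8 * 24, where 24 = 4! comes from the exponential
    series. *)
Lemma intble_quartic (R : realType) : intble (@normal_prob R 0 1) (fun x => (1 + `|x|) ^+ 4).
Proof.
apply: (intble_le _ (intbleD (intble_cst _ 8)
   (intbleZ 192 (intbleD (intble_expR 1) (intble_expR (-1)))))).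
  apply: measurable_funX; apply: measurable_funD => //; exact: measurableT_comp.
move=> x; rewrite ger0_norm ?exprn_ge0 ?addr_ge0// mul1r mulN1r.
have h : `|x| ^+ 4 <= 24 * (expR x + expR (- x)).
  have [x0|x0] := leP 0 x.
    by rewrite (ger0_norm x0); have := expR_ge_quartic x0; have := expR_ge0 (- x); lra.
  rewrite (ltr0_norm x0).
  by have := @expR_ge_quartic R (- x); rewrite oppr_ge0 (ltW x0) => /(_ isT); have := expR_ge0 x; lra.
by apply: (le_trans (exprD1_4_le (normr_ge0 x))); lra.
Qed.

(** Combines (1 + |x|)^4 <= 8 (1 + x^4) with exp(x^2 / 2) >= 1 + x^4 / 8; hence 64 = 8 * 8. *)
Lemma normal_pdf01_decay (R : realType) (x : R) :
  (1 + `|x|) ^+ 4 * normal_pdf 0 1 x <= 64 * normal_peak 1.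
Proof.
rewrite normal_pdf01 mulrCA mulrC ler_wpM2r ?normal_peak_ge0//.
rewrite mulNr expRN ler_pdivrMr ?expR_gt0//.
have x2 : 0 <= x ^+ 2 / 2 by rewrite divr_ge0 ?sqr_ge0.
have := @expR_ge1Dxn R _ 1 x2 => h.
apply: (@le_trans _ _ (64 * (1 + (x ^+ 2 / 2) ^+ 2 / 2))); last by rewrite ler_pM2l.
rewrite -(real_normK (num_real x)).
move: `|x| (normr_ge0 x) => y y0.
by have := exprD1_4_le y0; rewrite (_ : (y ^+ 2 / 2) ^+ 2 / 2 = y ^+ 4 / 8); [lra|field].
Qed.

(** Cubic growth is what the fourth moment requires, through g = x^3. The quartic decay of the
    density then leaves a factor 1 / (1 + |x|) at the boundary. *)
Lemma stein_cubic (R : realType) (g g' : R -> R) (c : R) :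
  (forall x : R, is_derive x (1 : R) g (g' x)) -> continuous g' ->
  (forall x, `|g x| <= (1 + `|x|) ^+ 3) -> (forall x, `|g' x| <= c * (1 + `|x|) ^+ 4) ->
  \int[normal_prob 0 1]_x (x * g x) = \int[normal_prob 0 1]_x g' x.
Proof.
move=> dg cg' gC g'C.
have cg : continuous g.
  by move=> x; apply: differentiable_continuous; apply/derivable1_diffP; apply: ex_derive; exact: dg.
apply: (@stein _ _ _ (64 * normal_peak 1)) => //.
- apply: intble_le (intble_quartic R) _.
    apply: continuous_measurable_fun => x.
    by apply: cvgM; [exact: cvg_id|exact: cg].
  move=> x; rewrite normrM (exprS _ 3) ler_pM// lerDr//.
- apply: intble_le (intbleZ c (intble_quartic R)) _ => //.
  exact: continuous_measurable_fun.
- move=> x; rewrite ler_pdivlMr ?ltr_pwDl//.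
  rewrite normrM (ger0_norm (normal_pdf_ge0 _ _ _)).
  apply: le_trans (normal_pdf01_decay x); rewrite mulrAC ler_wpM2r ?normal_pdf_ge0//.
  by rewrite exprSr ler_wpM2r// addr_ge0.
Qed.

Lemma gaussian_moment2 (R : realType) : \int[@normal_prob R 0 1]_x (x ^+ 2) = 1.
Proof.
transitivity (\int[@normal_prob R 0 1]_x (x * x)); first by apply: eq_Rintegral => x _; rewrite expr2.
rewrite (@stein_cubic _ id (cst 1) 1)//.
- exact: Rintegral_prob_cst.
- exact: cst_continuous.
- move=> x; have := normr_ge0 x; move: `|x| => y; nra.
- move=> x; rewrite /= normr1 mul1r exprn_ege1// lerDl//.
Qed.

Lemma gaussian_moment4 (R : realType) : \int[@normal_prob R 0 1]_x (x ^+ 4) = 3.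
Proof.
have i2 : intble (@normal_prob R 0 1) (fun x => x ^+ 2).
  apply: intble_le (intble_quartic R) _; first exact: measurable_funX.
  by move=> x; rewrite normrX; have := normr_ge0 x; move: `|x| => y; nra.
transitivity (\int[@normal_prob R 0 1]_x (x * x ^+ 3)).
  by apply: eq_Rintegral => x _; rewrite -exprS.
transitivity (\int[@normal_prob R 0 1]_x (3 * x ^+ 2)); last first.
  by rewrite RintegralZl// gaussian_moment2 mulr1.
apply: (@stein_cubic _ (fun x => x ^+ 3) (fun x => 3 * x ^+ 2) 3).
- by move=> x; apply: is_derive_eq; rewrite /GRing.scale/=; ring.
- by move=> x; apply: cvgM; [exact: cvg_cst|exact: exprn_continuous].
- by move=> x; rewrite normrX lerXn2r// ?nnegrE ?addr_ge0// lerDr.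
- move=> x; rewrite normrM normrX ger0_norm// ler_pM2l//.
  by have := normr_ge0 x; move: `|x| => y; nra.
Qed.

(** The integral F satisfies F'(t) = - t F(t): differentiate under the integral sign and apply
    Stein's identity to sin(t x). Hence F(t) exp(t^2 / 2) is constant, equal to its value 1 at 0. *)
Lemma gaussian_cos (R : realType) (t : R) :
  \int[@normal_prob R 0 1]_x cos (t * x) = expR (- (t ^+ 2 / 2)).
Proof.
pose F (t : R) := \int[@normal_prob R 0 1]_x cos (t * x).
have mcos (a : R) : measurable_fun setT (fun x => cos (a * x)).
  apply: continuous_measurable_fun => x; apply: continuous_comp.
    by apply: cvgM; [exact: cvg_cst|exact: cvg_id].
  exact: continuous_cos.
have icos (a : R) : intble (@normal_prob R 0 1) (fun x => cos (a * x)).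
  apply: (@intble_bounded _ _ _ (normal_prob 0 1) _ 1); first exact: mcos.
  move=> x;  by rewrite ler_norml cos_geN1 cos_le1.
have dcos (a x : R) : is_derive a (1 : R) (fun t => cos (t * x)) (- (x * sin (a * x))).
  by apply: is_derive_eq; rewrite /GRing.scale/=; ring.
have iabs : intble (@normal_prob R 0 1) (fun x => `|x|).
  apply: intble_le (intble_quartic R) _; first exact: measurableT_comp.
  by move=> x; rewrite normr_id; have := normr_ge0 x; move: `|x| => y; nra.
have d1 (a x : R) : partial1of2 (fun t x => cos (t * x)) a x = - (x * sin (a * x)).
  by rewrite partial1of2E; exact: derive_val.
have dF (a : R) : is_derive a (1 : R) F (- a * F a).
  have aI : `]a - 1, a + 1[%classic a by rewrite /= in_itv/=; lra.
  have H1 : forall x : R, `]a - 1, a + 1[%classic x -> intble (@normal_prob R 0 1) (fun y => cos (x * y)) by [].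
  have H2 : forall x y : R, `]a - 1, a + 1[%classic x -> [set: R] y -> derivable (fun t : R => cos (t * y)) x 1.
    by move=> x y _ _; exact: ex_derive.
  have H3 : forall x y : R, `]a - 1, a + 1[%classic x -> [set: R] y ->
      `|partial1of2 (fun t x => cos (t * x)) x y| <= `|y|.
    move=> x y _ _; rewrite d1 normrN normrM ler_piMr// ler_norml sin_geN1 sin_le1//.
  have dF := derivable_under_integral measurableT aI H1 H2 (fun y => normr_ge0 y) iabs H3.
  apply: DeriveDef => //.
  rewrite -derive1E (differentiation_under_integral measurableT aI H1 H2 (fun y => normr_ge0 y) iabs H3).
  under eq_Rintegral do rewrite d1.
  rewrite mulNr /F -RintegralZl//.
  transitivity (- \int[@normal_prob R 0 1]_x (x * sin (a * x))).
    rewrite -mulN1r -RintegralZl//; first by apply: eq_Rintegral => x _; rewrite mulN1r.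
    apply: intble_le iabs _.
      apply: continuous_measurable_fun => x; apply: cvgM; first exact: cvg_id.
      apply: continuous_comp; first by apply: cvgM; [exact: cvg_cst|exact: cvg_id].
      exact: continuous_sin.
    by move=> x; rewrite normrM ler_piMr// ler_norml sin_geN1 sin_le1.
  congr (- _); apply: (@stein_cubic _ _ _ `|a|).
  - by move=> x; apply: is_derive_eq; rewrite /GRing.scale/=; ring.
  - move=> x; apply: cvgM; first exact: cvg_cst.
    apply: continuous_comp; first by apply: cvgM; [exact: cvg_cst|exact: cvg_id].
    exact: continuous_cos.
  - move=> x; apply: (@le_trans _ _ 1); first by rewrite ler_norml sin_geN1 sin_le1.
    by rewrite exprn_ege1// lerDl.
  - move=> x; rewrite normrM ler_wpM2l//; apply: (@le_trans _ _ 1).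
      by rewrite ler_norml cos_geN1 cos_le1.
    by rewrite exprn_ege1// lerDl.
pose G (x : R) := F x * expR (x ^+ 2 / 2).
have dG (x : R) : is_derive x (1 : R) G 0.
  by have := dF x => dFx; apply: is_derive_eq; rewrite /GRing.scale/=; field.
have := is_derive_0_is_cst t 0 dG; rewrite /G expr0n/= mul0r expR0 mulr1.
have -> : F 0 = 1.
  rewrite /F -[RHS](Rintegral_prob_cst (@normal_prob R 0 1)).
  by apply: eq_Rintegral => x _; rewrite mul0r cos0.
move=> FtE; have e0 : expR (t ^+ 2 / 2) != 0 by rewrite gt_eqF// expR_gt0.
by apply: (mulIf e0); rewrite expRN mulVf.
Qed.

(** * The normal distribution function *)

Lemma EFin_Phi (R : realType) (x : R) : normal_prob 0 1 `]-oo, x] = (Phi x)%:E.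
Proof. by rewrite /Phi fineK// fin_num_measure. Qed.

Lemma EFin_tail (R : realType) (x : R) : normal_prob 0 1 `]x, +oo[ = (1 - Phi x)%:E.
Proof.
have := @probability_setC _ _ R (@normal_prob R 0 1) `]-oo, x]%classic (measurable_itv _).
by rewrite setCitvl/= EFin_Phi -EFinB.
Qed.

Lemma tail_integral (R : realType) (x : R) :
  ((1 - Phi x)%:E = \int[normal_prob 0 1]_y (\1_(`]x, +oo[%classic : set R) y)%:E)%E.
Proof. by rewrite -EFin_tail integral_indic//= setIT. Qed.

(** Markov's inequality for exp(b Y), the optimal exponent at level b. At the 1 - 1/n quantile b it
    yields exp(b^2 / 2) <= n, the source of every upper bound on that quantile. *)
Lemma Phi_chernoff (R : realType) (b : R) : 0 <= b -> 1 - Phi b <= expR (- (b ^+ 2 / 2)).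
Proof.
move=> b0; rewrite -lee_fin tail_integral.
apply: (@le_trans _ _ (\int[normal_prob 0 1]_y ((expR (- b ^+ 2))%:E * (expR (b * y))%:E))%E).
  apply: ge0_le_integral => //=.
  - exact/measurable_EFinP.
  - apply/measurable_EFinP; apply: measurable_funM => //.
    by apply: measurableT_comp => //; exact: measurable_funM.
  - move=> x _; rewrite -EFinM lee_fin indicE -expRD; have [|_] := boolP (_ \in _); last exact: expR_ge0.
    rewrite inE/= in_itv/= andbT => bx.
    by rewrite -[leLHS]expR0 ler_expR addrC subr_ge0 expr2 ler_wpM2l// ltW.
rewrite ge0_integralZl//=; first last.
  apply/measurable_EFinP.
  by apply: measurableT_comp => //; exact: measurable_funM.
rewrite ge0_integral_gaussian_expR -EFinM lee_fin -expRD ler_expR le_eqVlt; apply/orP; left.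
by apply/eqP; field.
Qed.

(** Shifting the density by a shows that the left side is the integral of exp(- a x - a^2 / 2) over
    x > b, where the integrand is at most exp(- a b). At the 1 - 1/n quantile the tail 1/n gains the
    factor exp(- a b), which makes a union bound over n terms vanish. *)
Lemma Phi_shift (R : realType) (b a : R) : 0 <= a ->
  1 - Phi (b + a) <= expR (- (a * b)) * (1 - Phi b).
Proof.
move=> a0; rewrite -lee_fin EFinM !tail_integral.
have mexp : measurable_fun setT (fun y : R => expR (- (a * y))).
  apply: measurableT_comp => //; apply: measurableT_comp => //; exact: measurable_funM.
have mi : measurable_fun setT (\1_(`]b + a, +oo[%classic : set R) : R -> R).
  exact: measurable_indic.
have := @ge0_integral_tilt R a 0 (fun y => expR (- (a * y)) * \1_(`]b + a, +oo[%classic : set R) y)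
  (lexx _) (measurable_funM mexp mi) (fun y => mulr_ge0 (expR_ge0 _) (ler0n _ _)).
rewrite [X in X = _ -> _](_ : _ =
  \int[normal_prob 0 1]_y (\1_(`]b + a, +oo[%classic : set R) y)%:E)%E; last first.
  apply: eq_integral => y _.
  by rewrite mulrA -expRD !mul0r subr0 subrr expR0 mul1r.
move=> ->; rewrite /tilt_mass addr0 sqrtr1 invr1 !mulr1.
have maff : measurable_fun setT (fun x : R => a + 1 * x).
  by apply: measurable_funD => //; exact: measurable_funM.
have mm : measurable_fun setT (fun x : R =>
    (expR (- (a * (a + 1 * x))) * \1_(`]b + a, +oo[%classic : set R) (a + 1 * x))).
  by apply: measurable_funM; [exact: measurableT_comp mexp maff|exact: measurableT_comp mi maff].
rewrite -!ge0_integralZl//=; first last.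
- exact/measurable_EFinP.
- by apply/measurable_EFinP; exact: measurable_indic.
apply: ge0_le_integral => //=.
- by apply/measurable_EFinP; apply: measurable_funM.
- by apply/measurable_EFinP; apply: measurable_funM => //; exact: measurable_indic.
- move=> x _; rewrite -!EFinM lee_fin !indicE mul1r.
  have [|_] := boolP (a + x \in _); last by rewrite !mulr0 mulr_ge0 ?expR_ge0.
  rewrite inE/= in_itv/= andbT addrC ltrD2l => bx.
  rewrite mem_set/= ?in_itv/= ?bx// !mulr1 -expRD ler_expR; nra.
Qed.

Lemma normal_prob_opp (R : realType) (A : set R) : measurable A ->
  normal_prob 0 1 A = normal_prob 0 1 ((fun x => -1 * x) @^-1` A).
Proof.
move=> mA.
have mf : measurable_fun setT (fun x : measurableTypeR R => (-1 * x : measurableTypeR R)).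
  exact: measurable_funM.
pose push := measure_function_pushforward__canonical__measure_function_Measure
    (@lebesgue_measure R) mf.
have mp : measurable_fun setT (EFin \o @normal_pdf R 0 1).
  by apply/measurable_EFinP; exact: measurable_normal_pdf.
rewrite /normal_prob.
rewrite (@eq_measure_integral _ (measurableTypeR R) R A push); last first.
  move=> B mB _; rewrite -[LHS]lebesgue_measureN// /push/= /pushforward.
  by congr lebesgue_measure; apply/funext => x /=; rewrite mulN1r.
rewrite ge0_integral_pushforward; last first.
- by move=> x _; rewrite lee_fin normal_pdf_ge0.
- exact: measurable_funTS.
- exact: mA.
- exact: mf.
by apply: eq_integral => x _; rewrite normal_pdf01 /= mulN1r sqrrN.
Qed.

Lemma Phi_opp (R : realType) (x : R) : Phi (- x) = 1 - Phi x.
Proof.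
have mitv : measurable (`]-oo, x]%classic : set R) by [].
apply: EFin_inj; rewrite -EFin_tail -EFin_Phi normal_prob_opp//.
rewrite (_ : _ @^-1` _ = `[x, +oo[%classic); last first.
  by apply/seteqP; split => y /=; rewrite !in_itv/= andbT mulN1r lerN2.
(* The reflected half-line is closed, but its endpoint has no mass since the law has a density. *)
rewrite /normal_prob integral_itv_obnd_cbnd//.
by apply/measurable_EFinP; apply: measurable_funTS; exact: measurable_normal_pdf.
Qed.

Lemma Phi_diff (R : realType) (x y : R) : x <= y ->
  normal_prob 0 1 `]x, y] = (Phi y - Phi x)%:E.
Proof.
move=> xy; have : normal_prob 0 1 (`]-oo, x] `|` `]x, y] : set R) =
    (normal_prob 0 1 `]-oo, x] + normal_prob 0 1 `]x, y])%E.
  rewrite measureU//; apply/seteqP; split => z //=; rewrite !in_itv/=.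
  by case=> zx /andP[xz _]; have := le_lt_trans zx xz; rewrite ltxx.
rewrite -itv_bndbnd_setU//.
rewrite !EFin_Phi => /(congr1 (fun e => (e - (Phi x)%:E)%E)).
by rewrite -EFinB => ->; rewrite addeAC subee// add0e.
Qed.

Lemma normal_peak1_le1 (R : realType) : normal_peak 1 <= 1 :> R.
Proof.
have p0 : 0 < Num.sqrt (pi *+ 2 : R) by rewrite sqrtr_gt0 pmulrn_lgt0// pi_gt0.
rewrite /normal_peak expr1n mul1r invf_le1//.
rewrite -[leLHS]sqrtr1 ler_wsqrtr//.
by move: (pi : R) (@pi_ge2 R) => p p2; rewrite mulr2n; lra.
Qed.

Lemma Phi_lipschitz (R : realType) (x y : R) : x <= y -> Phi y - Phi x <= y - x.
Proof.
move=> xy; rewrite -lee_fin -Phi_diff//.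
apply: (@le_trans _ _ (\int[lebesgue_measure]_(z in `]x, y]) (cst 1%E z))%E).
  apply: ge0_le_integral => //.
  - by move=> z _; rewrite lee_fin normal_pdf_ge0.
  - by apply: measurable_funTS; apply/measurable_EFinP; exact: measurable_normal_pdf.
  - move=> z _; rewrite lee_fin (le_trans _ (normal_peak1_le1 R))//.
    by apply: normal_pdf_ub; exact: oner_neq0.
rewrite integral_cst//= mul1e lebesgue_measure_itv/= lte_fin.
by case: ltP; rewrite -?EFinB// lee_fin subr_ge0.
Qed.

Lemma Phi_le (R : realType) (x y : R) : x <= y -> Phi x <= Phi y.
Proof. by move=> xy; rewrite -subr_ge0 -lee_fin -Phi_diff. Qed.

Lemma Phi_lt (R : realType) (x y : R) : x < y -> Phi x < Phi y.
Proof.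
move=> xy; rewrite -subr_gt0 -lte_fin -Phi_diff ?ltW//.
(* A lower bound for the density on [x, y], where z^2 <= x^2 + y^2. *)
pose c := normal_peak 1 * expR (- (x ^+ 2 + y ^+ 2) / 2).
have c0 : 0 < c by rewrite mulr_gt0 ?expR_gt0// normal_peak_gt0 ?oner_neq0.
apply: (@lt_le_trans _ _ (\int[lebesgue_measure]_(z in `]x, y]) (cst c%:E z))%E).
  rewrite integral_cst//= lebesgue_measure_itv/= lte_fin xy -EFinB -EFinM lte_fin.
  by rewrite mulr_gt0// subr_gt0.
apply: ge0_le_integral => //.
- by move=> z _; rewrite lee_fin ltW.
- by apply: measurable_funTS; apply/measurable_EFinP; exact: measurable_normal_pdf.
move=> z; rewrite /= in_itv/= => /andP[xz zy].
rewrite lee_fin normal_pdf01 ler_wpM2l ?normal_peak_ge0// ler_expR.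
rewrite ler_pM2r ?invr_gt0// lerN2; have [z0|z0] := leP 0 (z : R).
  by apply: ler_wpDl; [exact: sqr_ge0|nra].
by apply: ler_wpDr; [exact: sqr_ge0|nra].
Qed.

Lemma Phi_continuous (R : realType) : continuous (@Phi R).
Proof.
move=> x; apply/cvgrPdist_le => e e0; near=> y.
have : `|x - y| <= e by near: y; apply: cvgr_dist_le; [exact: cvg_id|exact: e0].
have [xy|/ltW yx] := leP x y; apply: le_trans.
  rewrite distrC [leRHS]distrC !ger0_norm ?subr_ge0 ?Phi_le//; exact: Phi_lipschitz.
rewrite !ger0_norm ?subr_ge0 ?Phi_le//; exact: Phi_lipschitz.
Unshelve. all: by end_near. Qed.

Lemma Phi_large (R : realType) (e : R) : 0 < e -> exists2 b, 0 <= b & 1 - Phi b <= e.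
Proof.
(* With this b, exp(b^2 / 2) >= 1 + b^2 / 2 >= 1 / e, so the Chernoff bound suffices. *)
move=> e0; exists (1 + e^-1); first by rewrite addr_ge0// invr_ge0 ltW.
have b0 : 0 <= 1 + e^-1 by rewrite addr_ge0// invr_ge0 ltW.
apply: (le_trans (Phi_chernoff b0)).
rewrite expRN invf_ple ?posrE ?expR_gt0//.
apply: (@le_trans _ _ (1 + (1 + e^-1) ^+ 2 / 2)); last exact: expR_ge1Dx.
by have : 0 < e^-1 by [rewrite invr_gt0]; move: e^-1 => y; nra.
Qed.

(** A partial inverse is a right inverse at every value that is attained, and the intermediate value
    theorem shows that [p] is attained. *)
Lemma Phi_invK (R : realType) (p : R) : 0 < p < 1 -> Phi (Phi_inv p) = p.
Proof.
move=> /andP[p0 p1]; rewrite /Phi_inv pinvK// inE.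
have [b b0 hb] : exists2 b, 0 <= b & 1 - Phi b <= 1 - p by apply: Phi_large; rewrite subr_gt0.
have [a a0 ha] := Phi_large p0.
have ab : - a <= b by lra.
have [c _ <-] : exists2 c, c \in `[- a, b] & Phi c = p; last by exists c.
apply: IVT => //.
  by apply: continuous_subspaceT; exact: Phi_continuous.
rewrite Phi_opp; apply/andP; split.
  by rewrite ge_min ha.
by rewrite le_max; apply/orP; right; lra.
Qed.

(** * Gaussian pairs *)

Lemma Rintegral_Fubini {d1 d2 : measure_display} {T1 : measurableType d1}
    {T2 : measurableType d2} {R : realType} (P1 : probability T1 R)
    (P2 : probability T2 R) (f : T1 * T2 -> R) (c : R) :
  measurable_fun setT f -> (forall z, `|f z| <= c) ->
  \int[P1]_x (\int[P2]_y f (x, y)) = \int[P2]_y (\int[P1]_x f (x, y)).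
Proof.
move=> mf fc.
have iF : (P1 \x P2)%E.-integrable setT (EFin \o f).
  apply: (@intble_bounded _ _ _ (P1 \x P2)%E f c) => //.
have i1 x : intble P2 (fun y => f (x, y)).
  by apply: (@intble_bounded _ _ _ P2 _ c) => //; exact: measurableT_comp.
have i2 y : intble P1 (fun x => f (x, y)).
  by apply: (@intble_bounded _ _ _ P1 _ c) => //; exact: measurableT_comp.
congr fine; transitivity (\int[P1]_x \int[P2]_y (f (x, y))%:E)%E.
  by apply: eq_integral => x _; rewrite fineK// (integrable_fin_num measurableT (i1 x)).
transitivity (\int[P2]_y \int[P1]_x (f (x, y))%:E)%E; first exact: (Fubini iF).
by apply: eq_integral => y _; rewrite fineK// (integrable_fin_num measurableT (i2 y)).
Qed.

Section gaussian_moments.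
Context {d : measure_display} {T : measurableType d} {R : realType}.
Variables (P : probability T R) (W : T -> R) (s : R).
Hypothesis gW : gaussian P W s.

Let gamma_exp (k : nat) : (k <= 4)%N -> intble (@normal_prob R 0 1) (fun x => x ^+ k).
Proof.
move=> k4; apply: intble_le (intble_quartic R) _; first exact: measurable_funX.
move=> x; rewrite normrX; apply: (@le_trans _ _ ((1 + `|x|) ^+ k)).
  by rewrite lerXn2r// ?nnegrE ?addr_ge0// lerDr.
by rewrite ler_weXn2l// lerDl.
Qed.

Let gamma_sexp (k : nat) : (k <= 4)%N -> intble (@normal_prob R 0 1) (fun x => (s * x) ^+ k).
Proof.
move=> k4; apply: eq_integrable (intbleZ (s ^+ k) (gamma_exp k4)) => // x _.
by rewrite /= exprMn.
Qed.

Lemma intble_gaussian_exp (k : nat) : (k <= 4)%N -> intble P (fun w => W w ^+ k).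
Proof.
move=> k4; apply: (integrable_gaussian gW (g := fun x => x ^+ k)); last exact: gamma_sexp.
exact: measurable_funX.
Qed.

Lemma gaussian_exp2 : \int[P]_w (W w ^+ 2) = s ^+ 2.
Proof.
rewrite (Rintegral_gaussian gW (g := fun x => x ^+ 2)); last exact: gamma_sexp.
  under eq_Rintegral do rewrite exprMn.
  by rewrite RintegralZl ?gamma_exp// gaussian_moment2 mulr1.
exact: measurable_funX.
Qed.

Lemma gaussian_exp4 : \int[P]_w (W w ^+ 4) = 3 * s ^+ 4.
Proof.
rewrite (Rintegral_gaussian gW (g := fun x => x ^+ 4)); last exact: gamma_sexp.
  under eq_Rintegral do rewrite exprMn.
  by rewrite RintegralZl ?gamma_exp// gaussian_moment4 mulrC.
exact: measurable_funX.
Qed.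

Lemma gaussian_cosD (c : R) : \int[P]_w cos (W w + c) = expR (- (s ^+ 2 / 2)) * cos c.
Proof.
have mcos (a : R) : measurable_fun setT (fun x => cos (a * x)).
  apply: continuous_measurable_fun => x; apply: continuous_comp.
    by apply: cvgM; [exact: cvg_cst|exact: cvg_id].
  exact: continuous_cos.
have msin (a : R) : measurable_fun setT (fun x => sin (a * x)).
  apply: continuous_measurable_fun => x; apply: continuous_comp.
    by apply: cvgM; [exact: cvg_cst|exact: cvg_id].
  exact: continuous_sin.
have mcosc : measurable_fun setT (fun x : R => cos (x + c)).
  apply: continuous_measurable_fun => x; apply: continuous_comp.
    by apply: cvgD; [exact: cvg_id|exact: cvg_cst].
  exact: continuous_cos.
have icos : intble (@normal_prob R 0 1) (fun x => cos (s * x)).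
  apply: (@intble_bounded _ _ _ (normal_prob 0 1) _ 1); first exact: mcos.
  by move=> x; rewrite ler_norml cos_geN1 cos_le1.
have isin : intble (@normal_prob R 0 1) (fun x => sin (s * x)).
  apply: (@intble_bounded _ _ _ (normal_prob 0 1) _ 1); first exact: msin.
  by move=> x; rewrite ler_norml sin_geN1 sin_le1.
(* The law is symmetric and sine is odd, so only the cosine part of the addition formula
   survives. *)
have sin0 : \int[@normal_prob R 0 1]_x sin (s * x) = 0.
  have gopp : gaussian (@normal_prob R 0 1) idfun (-1).
    split; first exact: measurable_id.
    by move=> A mA; rewrite -(normal_prob_opp mA).
  have := Rintegral_gaussian gopp (msin s).
  have -> : \int[normal_prob 0 1]_x sin (s * (-1 * x)) = - \int[@normal_prob R 0 1]_x sin (s * x).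
    rewrite -[RHS]mulN1r -RintegralZl//.
    by apply: eq_Rintegral => x _; rewrite mulN1r mulrN sinN mulN1r.
  have i' : intble (@normal_prob R 0 1) (fun x => sin (s * (-1 * x))).
    apply: eq_integrable (intbleZ (-1) isin) => // x _.
    by rewrite /= mulN1r mulN1r mulrN sinN.
  by move=> /(_ i') /=; lra.
rewrite (Rintegral_gaussian gW mcosc); last first.
  apply: (@intble_bounded _ _ _ (normal_prob 0 1) _ 1).
    by apply: measurableT_comp mcosc _; exact: measurable_funM.
  by move=> x; rewrite ler_norml cos_geN1 cos_le1.
transitivity (\int[@normal_prob R 0 1]_x (cos c * cos (s * x) - sin c * sin (s * x))).
  by apply: eq_Rintegral => x _; rewrite cosD mulrC (mulrC (sin c)).
rewrite RintegralB//; [|exact: intbleZ..].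
by rewrite !RintegralZl// sin0 gaussian_cos; ring.
Qed.

End gaussian_moments.

(* Independence of U and V is expressed through the laws of their linear
   combinations, which is the form in which joint Gaussianity is given. *)
Definition std_pair {d : measure_display} {T : measurableType d} {R : realType}
    (P : probability T R) (U V : T -> R) : Prop :=
  forall a b : R,
    gaussian P (fun w => a * U w + b * V w) (Num.sqrt (a ^+ 2 + b ^+ 2)).

Definition bump {R : realType} (k c x : R) : R := expR (- (k * (x - c) ^+ 2 / 2)).

Section bump.
Context {R : realType}.
Implicit Types k c x : R.

Lemma measurable_bump k c : measurable_fun setT (bump k c).
Proof.
apply: measurableT_comp => //; apply: measurableT_comp => //; apply: measurable_funM => //.
apply: measurable_funM => //; apply: measurable_funX; exact: measurable_funB.
Qed.

Lemma bump_ge0 k c x : 0 <= bump k c x. Proof. exact: expR_ge0. Qed.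

Lemma bump_le1 k c x : 0 <= k -> bump k c x <= 1.
Proof.
by move=> k0; rewrite expR_le1 oppr_le0 divr_ge0// mulr_ge0// sqr_ge0.
Qed.

(* Gaussian bumps are mixtures of the functions u |-> cos (u (x - c)), whose
   Gaussian expectations only depend on one-dimensional marginals. *)
Lemma bump_cos k c x : 0 <= k ->
  bump k c x = \int[@normal_prob R 0 1]_u cos (Num.sqrt k * u * (x - c)).
Proof.
move=> k0; rewrite /bump -{1}(sqr_sqrtr k0) -exprMn -gaussian_cos.
by apply: eq_Rintegral => u _; congr cos; ring.
Qed.

End bump.

Section std_pair.
Context {d : measure_display} {T : measurableType d} {R : realType}.
Variables (P : probability T R) (U V : T -> R).
Hypothesis UV : std_pair P U V.

Lemma std_pair_gaussianl : gaussian P U 1.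
Proof.
have := UV 1 0; rewrite expr1n expr0n/= addr0 sqrtr1.
by under eq_fun do rewrite mul1r mul0r addr0.
Qed.

Lemma std_pair_gaussianr : gaussian P V 1.
Proof.
have := UV 0 1; rewrite expr1n expr0n/= add0r sqrtr1.
by under eq_fun do rewrite mul1r mul0r add0r.
Qed.

Let mU : measurable_fun setT U := std_pair_gaussianl.1.
Let mV : measurable_fun setT V := std_pair_gaussianr.1.

Let gcos (a c : R) (W : T -> R) : gaussian P W 1 ->
  \int[P]_w cos (a * (W w - c)) = expR (- (a ^+ 2 / 2)) * cos (a * c).
Proof.
move=> gW; have ga : gaussian P (fun w => a * W w) a.
  split; first by apply: measurable_funM => //; exact: gW.1.
  move=> A mA; have maA : measurable ((fun x : R => a * x) @^-1` A).
    by rewrite -[X in measurable X]setTI; apply: measurable_funM.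
  have := gW.2 _ maA; rewrite /= => ->; congr normal_prob.
  by apply/funext => x /=; rewrite mul1r.
rewrite -cosN -(gaussian_cosD ga); apply: eq_Rintegral => w _.
by rewrite mulrBr.
Qed.

Let mcos (a c : R) (W : T -> R) : measurable_fun setT W ->
  measurable_fun setT (fun w => cos (a * (W w - c))).
Proof.
move=> mW; have mcc : measurable_fun setT (@cos R).
  by apply: continuous_measurable_fun; exact: continuous_cos.
apply: (measurableT_comp mcc); apply: measurable_funM => //; exact: measurable_funB.
Qed.

(** The product is half the sum of the cosines of two linear combinations, u U + v V and u U - v V
    up to constants. Both have variance u^2 + v^2, so the exponential factors split and the addition
    formulas reassemble the product. *)
Lemma std_pair_cosM (u v c : R) :
  \int[P]_w (cos (u * (U w - c)) * cos (v * (V w - c))) =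
  \int[P]_w cos (u * (U w - c)) * \int[P]_w cos (v * (V w - c)).
Proof.
have s2 (b : R) : Num.sqrt (u ^+ 2 + b ^+ 2) ^+ 2 = u ^+ 2 + b ^+ 2.
  by rewrite sqr_sqrtr// addr_ge0 ?sqr_ge0.
have mcc : measurable_fun setT (@cos R).
  by apply: continuous_measurable_fun; exact: continuous_cos.
have ic (b e : R) : intble P (fun w => cos (u * U w + b * V w + e)).
  apply: (@intble_bounded _ _ _ _ _ 1).
    by apply: (measurableT_comp mcc); apply: measurable_funD => //; exact: (UV u b).1.
  by move=> w; rewrite ler_norml cos_geN1 cos_le1.
transitivity (\int[P]_w (2^-1 * (cos (u * U w + v * V w + (- (u * c + v * c))) +
    cos (u * U w + (- v) * V w + (- (u * c - v * c)))))).
  apply: eq_Rintegral => w _.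
  rewrite (_ : _ + - (u * c + v * c) = u * (U w - c) + v * (V w - c)); last by ring.
  rewrite (_ : _ + - (u * c - v * c) = u * (U w - c) - v * (V w - c)); last by ring.
  by rewrite cosD cosB; field.
rewrite RintegralZl//; last exact: intbleD.
rewrite RintegralD//.
rewrite (gaussian_cosD (UV u v)) (gaussian_cosD (UV u (- v))) !s2 sqrrN.
rewrite !gcos; [|exact: std_pair_gaussianr|exact: std_pair_gaussianl].
rewrite !cosN cosD cosB.
rewrite (_ : - ((u ^+ 2 + v ^+ 2) / 2) = - (u ^+ 2 / 2) + - (v ^+ 2 / 2)); last by field.
rewrite expRD; move: (expR _) (expR _) => A B; by field.
Qed.

(** One bump at a time: [key] exchanges expectation and cosine mixture in the presence of any
    measurable [Y] bounded by 1. [step] takes for [Y] a cosine of [V], where [std_pair_cosM]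
    applies; the conclusion takes for [Y] the bump of [U], where [step] applies. *)
Lemma std_pair_bumpM (k c : R) : 0 <= k ->
  \int[P]_w (bump k c (U w) * bump k c (V w)) =
  \int[P]_w bump k c (U w) * \int[P]_w bump k c (V w).
Proof.
move=> k0; set g := @normal_prob R 0 1.
have mcc : measurable_fun setT (@cos R).
  by apply: continuous_measurable_fun; exact: continuous_cos.
have icos (a : R) (W : T -> R) : measurable_fun setT W -> intble P (fun w => cos (a * (W w - c))).
  move=> mW; apply: (@intble_bounded _ _ _ _ _ 1); first exact: mcos.
  by move=> w; rewrite ler_norml cos_geN1 cos_le1.
have key (W Y : T -> R) : measurable_fun setT W -> measurable_fun setT Y ->
    (forall w, `|Y w| <= 1) ->
    \int[P]_w (bump k c (W w) * Y w) =
    \int[g]_u \int[P]_w (cos (Num.sqrt k * u * (W w - c)) * Y w).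
  move=> mW mY Y1.
  rewrite -(@Rintegral_Fubini _ _ _ _ _ P g
    (fun z => cos (Num.sqrt k * z.2 * (W z.1 - c)) * Y z.1) 1).
  - apply: eq_Rintegral => w _; rewrite /= RintegralZr//; first by rewrite bump_cos.
    apply: (@intble_bounded _ _ _ g _ 1).
      apply: (measurableT_comp mcc); apply: measurable_funM => //; exact: measurable_funM.
    by move=> u; rewrite ler_norml cos_geN1 cos_le1.
  - apply: measurable_funM; last exact: measurableT_comp mY _.
    apply: (measurableT_comp mcc); apply: measurable_funM.
      by apply: measurable_funM => //; exact: measurable_snd.
    apply: measurable_funB => //; apply: measurableT_comp mW _; exact: measurable_fst.
  - move=> z; rewrite normrM mulr_ile1//.
    by rewrite ler_norml cos_geN1 cos_le1.
have b1 (W : T -> R) : forall w, `|bump k c (W w)| <= 1.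
  by move=> w; rewrite ger0_norm ?bump_ge0// bump_le1.
have mb (W : T -> R) : measurable_fun setT W -> measurable_fun setT (fun w => bump k c (W w)).
  by move=> mW; apply: (measurableT_comp (measurable_bump k c)).
have ib (W : T -> R) : measurable_fun setT W -> intble P (fun w => bump k c (W w)).
  by move=> mW; apply: (@intble_bounded _ _ _ _ _ 1); [exact: mb|exact: b1].
have key1 (W : T -> R) : measurable_fun setT W ->
    \int[P]_w bump k c (W w) = \int[g]_u \int[P]_w cos (Num.sqrt k * u * (W w - c)).
  move=> mW; have := @key W (cst 1) mW (measurable_cst _).
  under eq_Rintegral do rewrite /= mulr1.
  move=> ->; last by move=> w; rewrite normr1.
  by apply: eq_Rintegral => u _; apply: eq_Rintegral => w _; rewrite /= mulr1.
have iint (W : T -> R) : gaussian P W 1 ->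
    intble g (fun u => \int[P]_w cos (Num.sqrt k * u * (W w - c))).
  move=> gW; under eq_fun do rewrite gcos//.
  apply: (@intble_bounded _ _ _ g _ 1).
    apply: measurable_funM.
      apply: measurableT_comp => //; apply: measurableT_comp => //; apply: measurable_funM => //.
      by apply: measurable_funX; exact: measurable_funM.
    by apply: (measurableT_comp mcc); apply: measurable_funM => //; exact: measurable_funM.
  move=> u; rewrite normrM mulr_ile1//; last by rewrite ler_norml cos_geN1 cos_le1.
  by rewrite ger0_norm ?expR_ge0// expR_le1 oppr_le0 divr_ge0// sqr_ge0.
have step (v : R) : \int[P]_w (bump k c (U w) * cos (v * (V w - c))) =
    \int[P]_w bump k c (U w) * \int[P]_w cos (v * (V w - c)).
  rewrite key//; last 2 first.
  - exact: mcos.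
  - by move=> w; rewrite ler_norml cos_geN1 cos_le1.
  under eq_Rintegral do rewrite std_pair_cosM.
  rewrite (key1 U mU); apply: RintegralZr; first exact: measurableT.
  exact: iint std_pair_gaussianl.
transitivity (\int[P]_w (bump k c (V w) * bump k c (U w))).
  by apply: eq_Rintegral => w _; rewrite mulrC.
rewrite key//; last exact: mb.
transitivity (\int[g]_u (\int[P]_w bump k c (U w) *
    \int[P]_w cos (Num.sqrt k * u * (V w - c)))).
  apply: eq_Rintegral => u _; rewrite -step.
  by apply: eq_Rintegral => w _; rewrite mulrC.
rewrite (key1 V mV); apply: RintegralZl; first exact: measurableT.
exact: iint std_pair_gaussianr.
Qed.

End std_pair.

Section std_pair_moments.
Context {d : measure_display} {T : measurableType d} {R : realType}.
Variables (P : probability T R) (U V : T -> R).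
Hypothesis UV : std_pair P U V.

Let mU : measurable_fun setT U := (std_pair_gaussianl UV).1.
Let mV : measurable_fun setT V := (std_pair_gaussianr UV).1.

Let gpm (e : R) : e ^+ 2 = 1 -> gaussian P (fun w => U w + e * V w) (Num.sqrt 2).
Proof.
move=> e2; have := UV 1 e; rewrite expr1n e2 -[1 + 1]/(2%:R).
by under eq_fun do rewrite mul1r.
Qed.

(** Polarization: (U + V)^4 + (U - V)^4 = 2 U^4 + 12 U^2 V^2 + 2 V^4 reduces the mixed moment to
    moments of single Gaussian variables. *)
Lemma std_pair_sqrM : \int[P]_w ((U w ^+ 2 - 1) * (V w ^+ 2 - 1)) = 0.
Proof.
have gp := @gpm 1 (expr1n R 2).
have gm : gaussian P (fun w => U w + (-1) * V w) (Num.sqrt 2) by apply: gpm; rewrite sqrrN expr1n.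
have gU := std_pair_gaussianl UV; have gV := std_pair_gaussianr UV.
have s2 : Num.sqrt 2 ^+ 2 = 2 :> R by rewrite sqr_sqrtr.
have s4 : Num.sqrt 2 ^+ 4 = 4 :> R by rewrite (exprM _ 2 2) s2; ring.
have i4 (W : T -> R) s : gaussian P W s -> intble P (fun w => W w ^+ 4).
  by move=> gW; exact: (intble_gaussian_exp gW (isT : (4 <= 4)%N)).
have i2 (W : T -> R) s : gaussian P W s -> intble P (fun w => W w ^+ 2).
  by move=> gW; exact: (intble_gaussian_exp gW (isT : (2 <= 4)%N)).
transitivity (\int[P]_w (12^-1 * ((U w + 1 * V w) ^+ 4 + (U w + (-1) * V w) ^+ 4
   - (2 * U w ^+ 4 + 2 * V w ^+ 4)) - (U w ^+ 2 + V w ^+ 2 - 1))).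
  by apply: eq_Rintegral => w _; field.
have ip := i4 _ _ gp; have im := i4 _ _ gm.
have iU := i4 _ _ gU; have iV := i4 _ _ gV.
have jU := i2 _ _ gU; have jV := i2 _ _ gV.
rewrite RintegralB//; last first.
- by apply: intbleB; [exact: intbleD|exact: intble_cst].
- by apply/intbleZ/intbleB; apply: intbleD => //; exact: intbleZ.
rewrite RintegralZl//; last by apply: intbleB; apply: intbleD => //; exact: intbleZ.
rewrite !(RintegralB, RintegralD, RintegralZl)//.
- rewrite (gaussian_exp4 gp) (gaussian_exp4 gm) (gaussian_exp4 gU) (gaussian_exp4 gV).
  rewrite (gaussian_exp2 gU) (gaussian_exp2 gV) Rintegral_prob_cst !expr1n s4.
  by field.
- exact: intbleD.
- exact: intble_cst.
- exact: intbleZ.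
- exact: intbleZ.
- exact: intbleD.
- by apply: intbleD; exact: intbleZ.
Qed.

Lemma std_pair_M : \int[P]_w (U w * V w) = 0.
Proof.
have gp := @gpm 1 (expr1n R 2).
have gm : gaussian P (fun w => U w + (-1) * V w) (Num.sqrt 2) by apply: gpm; rewrite sqrrN expr1n.
have ip := intble_gaussian_exp gp (isT : (2 <= 4)%N).
have im := intble_gaussian_exp gm (isT : (2 <= 4)%N).
transitivity (\int[P]_w (4^-1 * ((U w + 1 * V w) ^+ 2 - (U w + (-1) * V w) ^+ 2))).
  by apply: eq_Rintegral => w _; field.
rewrite RintegralZl ?intbleB// RintegralB//.
by rewrite (gaussian_exp2 gp) (gaussian_exp2 gm) subrr mulr0.
Qed.

End std_pair_moments.

Lemma gaussian_sqr_variance {d : measure_display} {T : measurableType d} {R : realType}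
    (P : probability T R) (U : T -> R) : gaussian P U 1 ->
  \int[P]_w ((U w ^+ 2 - 1) ^+ 2) = 2.
Proof.
move=> gU.
have i4 := intble_gaussian_exp gU (isT : (4 <= 4)%N).
have i2 := intble_gaussian_exp gU (isT : (2 <= 4)%N).
transitivity (\int[P]_w (U w ^+ 4 - (2 * U w ^+ 2 - 1))).
  by apply: eq_Rintegral => w _; ring.
rewrite !(RintegralB, RintegralZl)//.
- by rewrite (gaussian_exp4 gU) (gaussian_exp2 gU) Rintegral_prob_cst !expr1n; ring.
- exact: intbleZ.
- exact: intble_cst.
- by apply: intbleB; [exact: intbleZ|exact: intble_cst].
Qed.

Lemma intble_gaussian_sqr_variance {d : measure_display} {T : measurableType d} {R : realType}
    (P : probability T R) (U : T -> R) : gaussian P U 1 ->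
  intble P (fun w => (U w ^+ 2 - 1) ^+ 2).
Proof.
move=> gU.
have i4 := intble_gaussian_exp gU (isT : (4 <= 4)%N).
have i2 := intble_gaussian_exp gU (isT : (2 <= 4)%N).
have := intbleB i4 (intbleB (intbleZ 2 i2) (intble_cst P 1)).
by apply: eq_integrable => // w _; congr EFin; rewrite /=; ring.
Qed.

(* Pairwise orthogonality is all that the second moment of a sum needs. *)
Lemma Rintegral_sqr_sum {d : measure_display} {T : measurableType d} {R : realType}
    (P : probability T R) (I : finType) (A : {set I}) (t : I -> R) (F : I -> T -> R) :
  (forall i, i \in A -> measurable_fun setT (F i)) ->
  (forall i, i \in A -> intble P (fun w => F i w ^+ 2)) ->
  (forall i j, i \in A -> j \in A -> i != j -> \int[P]_w (F i w * F j w) = 0) ->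
  \int[P]_w ((\sum_(i in A) t i * F i w) ^+ 2) =
  \sum_(i in A) t i ^+ 2 * \int[P]_w (F i w ^+ 2).
Proof.
move=> mF iF ortho.
have iM i j : i \in A -> j \in A -> intble P (fun w => F i w * F j w).
  by move=> iA jA; apply: intbleM; [exact: mF|exact: mF|exact: iF|exact: iF].
transitivity (\int[P]_w (\sum_(i in A) \sum_(j in A) (t i * t j) * (F i w * F j w))).
  apply: eq_Rintegral => w _; rewrite expr2 mulr_suml; apply: eq_bigr => i _.
  by rewrite mulr_sumr; apply: eq_bigr => j _; ring.
rewrite Rintegral_sum; last first.
  by move=> i iA; apply: intble_sum => j jA; exact/intbleZ/iM.
apply: eq_bigr => i iA; rewrite Rintegral_sum; last first.
  by move=> j jA; exact/intbleZ/iM.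
rewrite (bigD1 i)//= big1 ?addr0.
  by rewrite RintegralZl ?iM// expr2; congr (_ * _).
move=> j /andP[jA ji]; rewrite RintegralZl ?iM// ortho ?mulr0//.
by rewrite eq_sym.
Qed.

Lemma intble_sqr_sum {d : measure_display} {T : measurableType d} {R : realType}
    (P : probability T R) (I : finType) (A : {set I}) (t : I -> R) (F : I -> T -> R) :
  (forall i, i \in A -> measurable_fun setT (F i)) ->
  (forall i, i \in A -> intble P (fun w => F i w ^+ 2)) ->
  intble P (fun w => (\sum_(i in A) t i * F i w) ^+ 2).
Proof.
move=> mF iF.
have iM i j : i \in A -> j \in A -> intble P (fun w => F i w * F j w).
  by move=> iA jA; apply: intbleM; [exact: mF|exact: mF|exact: iF|exact: iF].
have : intble P (fun w => \sum_(i in A) \sum_(j in A) (t i * t j) * (F i w * F j w)).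
  by apply: intble_sum => i iA; apply: intble_sum => j jA; exact/intbleZ/iM.
apply: eq_integrable => // w _; congr EFin; rewrite expr2 mulr_suml; apply: eq_bigr => i _.
by rewrite mulr_sumr; apply: eq_bigr => j _; ring.
Qed.

(** * Maxima of pairwise independent Gaussians *)

Lemma prob_le_Rintegral {d : measure_display} {T : measurableType d} {R : realType}
    (P : probability T R) (E : set T) (g : T -> R) :
  measurable E -> intble P g -> (forall w, 0 <= g w) -> (forall w, E w -> 1 <= g w) ->
  (P E <= (\int[P]_w g w)%:E)%E.
Proof.
move=> mE ig g0 g1;
have -> : P E = (\int[P]_w (\1_E w)%:E)%E by rewrite integral_indic// setIT.
rewrite /Rintegral fineK; last exact: integrable_fin_num ig.
apply: ge0_le_integral => //.
- by apply/measurable_EFinP; exact: measurable_indic.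
- by apply/measurable_EFinP; exact: intble_measurable ig.
move=> w _; rewrite lee_fin indicE; have [|_] := boolP (w \in E); last exact: g0.
by rewrite inE => /g1.
Qed.

(* Second moment method: the average of the F i concentrates around 1, while
   on the event in question it has the small mean of the F i * 1_(B i). *)
Lemma second_moment {d : measure_display} {T : measurableType d} {R : realType}
    (P : probability T R) (I : finType) (A : {set I}) (F : I -> T -> R)
    (B : I -> set T) (r e : R) : (0 < #|A|)%N ->
  (forall i, i \in A -> measurable (B i)) ->
  (forall i, i \in A -> measurable_fun setT (F i)) ->
  (forall i w, 0 <= F i w) ->
  (forall i, i \in A -> intble P (fun w => F i w ^+ 2)) ->
  (forall i, i \in A -> \int[P]_w F i w = 1) ->
  (forall i, i \in A -> \int[P]_w (F i w ^+ 2) <= r) ->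
  (forall i j, i \in A -> j \in A -> i != j -> \int[P]_w (F i w * F j w) = 1) ->
  (forall i, i \in A -> \int[P]_w (F i w * \1_(B i) w) <= e) ->
  (P [set w | forall i, i \in A -> B i w] <= (4 * (r / #|A|%:R) + 2 * e)%:E)%E.
Proof.
move=> A0 mB mF F0 iF2 F1 Fr FF FB; set k := #|A|%:R : R.
have k0 : 0 < k by rewrite ltr0n.
have iF i : i \in A -> intble P (F i).
  move=> iA; apply: intble_le (intbleD (iF2 i iA) (intble_cst P 1)) _; first exact: mF.
  by move=> w; rewrite ger0_norm//; have := F0 i w; move: (F i w) => y; nra.
pose G i w := F i w - 1.
have mG i : i \in A -> measurable_fun setT (G i).
  by move=> iA; apply: measurable_funB => //; exact: mF.
have iFF i j : i \in A -> j \in A -> intble P (fun w => F i w * F j w).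
  by move=> iA jA; apply: intbleM; [exact: mF|exact: mF|exact: iF2|exact: iF2].
have GG i j : i \in A -> j \in A ->
    \int[P]_w (G i w * G j w) = \int[P]_w (F i w * F j w) - 1.
  move=> iA jA.
  transitivity (\int[P]_w (F i w * F j w - (F i w + F j w - 1))).
    by apply: eq_Rintegral => w _; rewrite /G; ring.
  have iD := intbleD (iF i iA) (iF j jA).
  rewrite !(RintegralB, RintegralD)//.
  - by rewrite !F1// Rintegral_prob_cst; ring.
  - exact: iF.
  - exact: iF.
  - exact: intble_cst.
  - exact: iFF.
  - by apply: intbleB => //; exact: intble_cst.
have iG2 i : i \in A -> intble P (fun w => G i w ^+ 2).
  move=> iA; have := intbleB (iF2 i iA) (intbleB (intbleZ 2 (iF i iA)) (intble_cst P 1)).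
  by apply: eq_integrable => // w _; congr EFin; rewrite /G/=; ring.
pose S w := \sum_(i in A) k^-1 * G i w.
pose S' w := \sum_(i in A) k^-1 * (F i w * \1_(B i) w).
have iFB i : i \in A -> intble P (fun w => F i w * \1_(B i) w).
  move=> iA; apply: intble_le (iF i iA) _.
    by apply: measurable_funM; [exact: mF|apply: measurable_indic; exact: mB].
  move=> w; rewrite normrM (ger0_norm (F0 _ _)) indicE.
  by case: (_ \in _); rewrite ?normr1 ?mulr1// normr0 mulr0.
have iS2 : intble P (fun w => S w ^+ 2) by exact: intble_sqr_sum.
have iS' : intble P S' by apply: intble_sum => i iA; exact/intbleZ/iFB.
(* On the event [S] equals [S'] - 1, and 4 (y - 1)^2 + 2 y >= 1 for every real y. The mean of the
   first term is bounded by orthogonality, that of the second by the hypothesis on the [B i]. *)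
apply: (@le_trans _ _ (\int[P]_w (4 * S w ^+ 2 + 2 * S' w))%:E).
  apply: prob_le_Rintegral.
  - rewrite (_ : [set _ | _] = \bigcap_(i in [set` A]) B i).
      by apply: fin_bigcap_measurable => //; exact: finite_finset.
    by apply/seteqP; split.
  - by apply: intbleD; exact: intbleZ.
  - move=> w; apply: addr_ge0; first by rewrite mulr_ge0// sqr_ge0.
    by rewrite mulr_ge0// sumr_ge0// => i iA; rewrite !mulr_ge0// ?invr_ge0 ?ltW.
  - move=> w /= wB; have -> : S w = S' w - 1.
      rewrite /S /S' /G -!mulr_sumr sumrB big_const iter_addr_0 mulrBr.
      congr (_ - _); last by rewrite -/k mulVf// gt_eqF.
      congr (_ * _); apply: eq_bigr => i iA.
      by rewrite indicE mem_set ?mulr1//; exact: wB.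
    move: (S' w) => y; rewrite -subr_ge0.
    rewrite [leRHS](_ : _ = 4 * (y - 3 / 4) ^+ 2 + 3 / 4); last by field.
    by rewrite addr_ge0// mulr_ge0// sqr_ge0.
rewrite lee_fin RintegralD//; [|exact: intbleZ..].
rewrite !RintegralZl//; apply: lerD; rewrite ler_pM2l//.
  rewrite Rintegral_sqr_sum//; last first.
    by move=> i j iA jA ij; rewrite GG// FF// subrr.
  apply: (@le_trans _ _ (\sum_(i in A) k^-1 ^+ 2 * r)).
    apply: ler_sum => i iA; rewrite ler_wpM2l ?sqr_ge0//.
    under eq_Rintegral do rewrite expr2.
    rewrite GG//; under eq_Rintegral do rewrite -expr2.
    by have := Fr i iA; lra.
  rewrite big_const iter_addr_0 -mulr_natr -/k le_eqVlt; apply/orP; left; apply/eqP.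
  by field; rewrite gt_eqF.
rewrite Rintegral_sum; last by move=> i iA; exact/intbleZ/iFB.
apply: (@le_trans _ _ (\sum_(i in A) k^-1 * e)).
  by apply: ler_sum => i iA; rewrite RintegralZl ?iFB//;
    apply: ler_wpM2l; [rewrite invr_ge0 ltW|exact: FB].
rewrite big_const iter_addr_0 -mulr_natr -/k le_eqVlt; apply/orP; left; apply/eqP.
by field; rewrite gt_eqF.
Qed.

Lemma Rintegral_std {d : measure_display} {T : measurableType d} {R : realType}
    (P : probability T R) (U : T -> R) (g : R -> R) (c : R) :
  gaussian P U 1 -> measurable_fun setT g -> (forall x, `|g x| <= c) ->
  \int[P]_w g (U w) = \int[normal_prob 0 1]_x g x.
Proof.
move=> gU mg gc; rewrite (Rintegral_gaussian gU mg).
  by apply: eq_Rintegral => x _; rewrite mul1r.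
apply: (@intble_bounded _ _ _ (normal_prob 0 1) _ c) => //.
by apply: measurableT_comp mg _; exact: measurable_funM.
Qed.

(** * Likelihood ratios of shifted and concentrated Gaussians *)

Section tilted_density.
Context {R : realType}.
Variables (a k : R).
Hypothesis k0 : 0 < k.

Let l := a * (1 + k).
Let C := tilt_mass l k.

Let k1 : 0 < 1 + k. Proof. by rewrite addr_gt0. Qed.

Let C0 : 0 < C.
Proof. by rewrite /C /tilt_mass divr_gt0 ?expR_gt0// sqrtr_gt0. Qed.

(* The density of N(a, 1 / (1 + k)) with respect to N(0, 1). *)
Definition tilted (x : R) : R := expR (a * (1 + k) * x - k * x ^+ 2 / 2) / tilt_mass (a * (1 + k)) k.

Lemma tilted_ge0 x : 0 <= tilted x.
Proof. by rewrite divr_ge0 ?expR_ge0// ltW. Qed.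

(** As a function of x the likelihood ratio is a multiple of a bump, centred at l / k rather than at
    a. It is therefore bounded, and the product formula for bumps applies to it. *)
Lemma tiltedE x : tilted x = expR (l ^+ 2 / (2 * k)) / C * bump k (l / k) x.
Proof.
rewrite /tilted /bump [RHS]mulrAC -expRD; congr (expR _ / _); rewrite /l; field.
by rewrite gt_eqF.
Qed.

Lemma measurable_tilted : measurable_fun setT tilted.
Proof.
rewrite (_ : tilted = fun x => expR (l ^+ 2 / (2 * k)) / C * bump k (l / k) x).
  by apply: measurable_funM => //; exact: measurable_bump.
by apply/funext => x; exact: tiltedE.
Qed.

Lemma tilted_bounded x : `|tilted x| <= expR (l ^+ 2 / (2 * k)) / C.
Proof.
rewrite ger0_norm ?tilted_ge0// tiltedE ler_piMr//; last by rewrite bump_le1// ltW.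
by rewrite divr_ge0 ?expR_ge0// ltW.
Qed.

Lemma ge0_integral_tilted (h : R -> R) : measurable_fun setT h -> (forall x, 0 <= h x) ->
  (\int[normal_prob 0 1]_x (tilted x * h x)%:E =
   \int[normal_prob 0 1]_x (h (a + (Num.sqrt (1 + k))^-1 * x))%:E)%E.
Proof.
move=> mh h0; have := @ge0_integral_tilt R l k (fun x => C^-1 * h x) (ltW k0).
rewrite (_ : l / (1 + k) = a); last by rewrite /l mulfK// gt_eqF.
move=> /(_ _ _)/[dup] H.
transitivity (\int[normal_prob 0 1]_x (expR (l * x - k * x ^+ 2 / 2) * (C^-1 * h x))%:E)%E.
  by apply: eq_integral => x _; rewrite mulrA.
rewrite H; last 2 first.
- exact: measurable_funM.
- by move=> x; rewrite mulr_ge0// invr_ge0 ltW.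
have mh' : measurable_fun setT (fun x : R => (C^-1 * h (a + (Num.sqrt (1 + k))^-1 * x))).
  apply: measurable_funM => //; apply: measurableT_comp mh _.
  by apply: measurable_funD => //; exact: measurable_funM.
rewrite -/C -ge0_integralZl//=; last first.
- by rewrite lee_fin ltW.
- by move=> x _; rewrite lee_fin mulr_ge0// invr_ge0 ltW.
- exact/measurable_EFinP.
by apply: eq_integral => x _; rewrite -EFinM mulrA divff ?mul1r// gt_eqF.
Qed.

Lemma Rintegral_tilted : \int[normal_prob 0 1]_x tilted x = 1.
Proof.
transitivity (\int[normal_prob 0 1]_x (tilted x * cst 1 x)).
  by apply: eq_Rintegral => x _; rewrite /= mulr1.
by rewrite /Rintegral ge0_integral_tilted//; exact: (@Rintegral_prob_cst _ _ _ (@normal_prob R 0 1) 1).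
Qed.

(** The squared weight is again an exponential weight, with 2 l and 2 k in place of l and k, so a
    second tilt evaluates it. The exponent decreases from a^2 at k = 0 to a^2 / 2 as k grows. *)
Lemma Rintegral_tilted_sqr : \int[normal_prob 0 1]_x (tilted x ^+ 2) =
  (1 + k) / Num.sqrt (1 + 2 * k) * expR (a ^+ 2 * (1 + k) / (1 + 2 * k)).
Proof.
have k2 : 0 < 1 + 2 * k by rewrite addr_gt0// mulr_gt0.
have := @ge0_integral_tilt R (2 * l) (2 * k) (cst (C^-1 ^+ 2)).
rewrite mulr_ge0 ?ltW// => /(_ isT (measurable_cst _) (fun=> sqr_ge0 _)).
rewrite [X in X = _ -> _](_ : _ = \int[normal_prob 0 1]_x (tilted x ^+ 2)%:E)%E; last first.
  apply: eq_integral => x _; rewrite /tilted exprMn -expRM_natl; congr (expR _ * _)%:E.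
  by rewrite /l; field.
rewrite [X in _ = (_ * X)%E -> _](_ : _ = (C^-1 ^+ 2)%:E); last first.
  rewrite /= integral_cst// [X in (_ * X)%E](_ : _ = 1%E) ?mule1//; exact: probability_setT.
rewrite /Rintegral => ->; rewrite -EFinM /= /C /tilt_mass.
have q2 : Num.sqrt (1 + k) ^+ 2 = 1 + k by rewrite sqr_sqrtr// ltW.
rewrite (_ : (expR (l ^+ 2 / (2 * (1 + k))) / Num.sqrt (1 + k))^-1 ^+ 2 =
  (1 + k) * expR (2%:R * - (l ^+ 2 / (2 * (1 + k))))); last first.
  rewrite expRM_natl expRN; move: (expR _) => A.
  by rewrite invfM invrK exprMn q2 mulrC.
transitivity ((1 + k) / Num.sqrt (1 + 2 * k) *
  (expR ((2 * l) ^+ 2 / (2 * (1 + 2 * k))) * expR (2%:R * - (l ^+ 2 / (2 * (1 + k)))))); first by ring.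
rewrite -expRD; congr (_ * expR _); rewrite /l; field.
by rewrite !gt_eqF.
Qed.

(** Chebyshev's inequality under N(a, 1 / (1 + k)). *)
Lemma Rintegral_tilted_left (e : R) : 0 < e ->
  \int[normal_prob 0 1]_x (tilted x * \1_(`]-oo, a - e]%classic : set R) x) <=
    ((1 + k) * e ^+ 2)^-1.
Proof.
move=> e0; set q := (Num.sqrt (1 + k))^-1.
have q2 : q ^+ 2 = (1 + k)^-1 by rewrite /q exprVn sqr_sqrtr// ltW.
have i2 : intble (@normal_prob R 0 1) (fun x => x ^+ 2).
  apply: intble_le (intble_quartic R) _; first exact: measurable_funX.
  by move=> x; rewrite normrX; have := normr_ge0 x; move: `|x| => y; nra.
have mi : measurable_fun setT (\1_(`]-oo, a - e]%classic : set R) : R -> R).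
  exact: measurable_indic.
have maff : measurable_fun setT (fun x : R => a + q * x).
  by apply: measurable_funD => //; exact: measurable_funM.
rewrite {1}/Rintegral ge0_integral_tilted//.
apply: (@le_trans _ _ (\int[normal_prob 0 1]_x (((1 + k) * e ^+ 2)^-1 * x ^+ 2))); last first.
  by rewrite RintegralZl// gaussian_moment2 mulr1.
apply: le_Rintegral => //.
- apply: (@intble_bounded _ _ _ (normal_prob 0 1) _ 1); first exact: measurableT_comp mi maff.
  by move=> x; rewrite indicE; case: (_ \in _); rewrite ?normr1 ?normr0.
- exact: intbleZ.
- move=> x _; rewrite indicE; have [|_] := boolP (_ \in _); last first.
    by rewrite mulr_ge0 ?sqr_ge0// invr_ge0 mulr_ge0 ?sqr_ge0// ltW.
  rewrite inE/= in_itv/= -/q => axe.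
  rewrite invfM -q2 mulrAC -exprMn ler_pdivlMr ?exprn_gt0// mul1r.
  by rewrite -[leRHS]sqrrN lerXn2r// ?nnegrE; lra.
Qed.

End tilted_density.

Lemma std_pair_tilted {d : measure_display} {T : measurableType d} {R : realType}
    (P : probability T R) (U V : T -> R) (a k : R) : 0 < k -> std_pair P U V ->
  \int[P]_w (tilted a k (U w) * tilted a k (V w)) = 1.
Proof.
move=> k0 UV; have gU := std_pair_gaussianl UV; have gV := std_pair_gaussianr UV.
have tb := tilted_bounded a k0; have mt := measurable_tilted a k0.
set D := expR ((a * (1 + k)) ^+ 2 / (2 * k)) / tilt_mass (a * (1 + k)) k.
set c := a * (1 + k) / k.
have mb (W : T -> R) : gaussian P W 1 -> measurable_fun setT (fun w => bump k c (W w)).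
  by move=> gW; exact: measurableT_comp (measurable_bump k c) gW.1.
have b1 x : `|bump k c x| <= 1 by rewrite ger0_norm ?bump_ge0// bump_le1// ltW.
have E1 (W : T -> R) : gaussian P W 1 -> D * \int[P]_w bump k c (W w) = 1.
  move=> gW; rewrite -(Rintegral_tilted a k0) -(Rintegral_std gW mt tb).
  rewrite -RintegralZl//; first by apply: eq_Rintegral => w _; rewrite tiltedE.
  by apply: (@intble_bounded _ _ _ P _ 1) => //; exact: mb.
transitivity (\int[P]_w (D ^+ 2 * (bump k c (U w) * bump k c (V w)))).
  by apply: eq_Rintegral => w _; rewrite !tiltedE// -/D -/c; ring.
rewrite RintegralZl//; last first.
  apply: (@intble_bounded _ _ _ P _ 1); first by apply: measurable_funM; exact: mb.
  by move=> w; rewrite normrM mulr_ile1.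
rewrite std_pair_bumpM ?ltW//.
rewrite [LHS](_ : _ = (D * \int[P]_w bump k c (U w)) * (D * \int[P]_w bump k c (V w))); last by ring.
by rewrite !E1// mulr1.
Qed.

(** The likelihood ratios of N(a, 1 / (1 + k)) serve as [F] in the second moment method: they have
    mean 1, their pairwise products have mean 1, and they put little mass on the event that a
    variable stays [e] below [a]. *)
Lemma gaussian_max_lower {d : measure_display} {T : measurableType d} {R : realType}
    (P : probability T R) (I : finType) (A : {set I}) (U : I -> T -> R) (a k e : R) :
  0 < k -> 0 < e -> (0 < #|A|)%N ->
  (forall i, i \in A -> gaussian P (U i) 1) ->
  (forall i j, i \in A -> j \in A -> i != j -> std_pair P (U i) (U j)) ->
  (P [set w | forall i, i \in A -> (U i w <= a - e)%R] <=
   (4 * ((1 + k) / Num.sqrt (1 + 2 * k) * expR (a ^+ 2 * (1 + k) / (1 + 2 * k)) / #|A|%:R) +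
    2 * ((1 + k) * e ^+ 2)^-1)%:E)%E.
Proof.
move=> k0 e0 A0 gU UU.
have tb := tilted_bounded a k0; have mt := measurable_tilted a k0.
apply: (@second_moment _ _ _ _ _ _ (fun i w => tilted a k (U i w)) (fun i => [set w | U i w <= a - e]%R)).
- exact: A0.
- move=> i iA; rewrite -[X in measurable X]setTI.
  rewrite (_ : [set w | _] = U i @^-1` `]-oo, a - e]).
    by apply: (gU i iA).1.
  by apply/seteqP; split => w /=; rewrite in_itv.
- by move=> i iA; exact: measurableT_comp mt (gU i iA).1.
- by move=> i w; exact: tilted_ge0.
- move=> i iA; apply: (@intble_bounded _ _ _ P _ ((expR ((a * (1 + k)) ^+ 2 / (2 * k)) / tilt_mass (a * (1 + k)) k) ^+ 2)).
    by apply: measurable_funX; exact: measurableT_comp mt (gU i iA).1.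
  by move=> w; rewrite normrX lerXn2r// ?nnegrE// (le_trans _ (tb 0)).
- by move=> i iA; rewrite (Rintegral_std (gU i iA) mt tb) Rintegral_tilted.
- move=> i iA; rewrite -Rintegral_tilted_sqr//.
  rewrite (@Rintegral_std _ _ _ _ _ (fun x => tilted a k x ^+ 2)
    ((expR ((a * (1 + k)) ^+ 2 / (2 * k)) / tilt_mass (a * (1 + k)) k) ^+ 2) (gU i iA))//.
    exact: measurable_funX.
  by move=> w; rewrite normrX lerXn2r// ?nnegrE// (le_trans _ (tb 0)).
- by move=> i j iA jA ij; apply: std_pair_tilted => //; exact: UU.
- move=> i iA; apply: (le_trans _ (Rintegral_tilted_left a k0 e0)).
  rewrite -(@Rintegral_std _ _ _ _ _ (fun x => tilted a k x * \1_(`]-oo, a - e]%classic : set R) x)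
    (expR ((a * (1 + k)) ^+ 2 / (2 * k)) / tilt_mass (a * (1 + k)) k) (gU i iA)).
  + rewrite le_eqVlt; apply/orP; left; apply/eqP; apply: eq_Rintegral => w _.
    by rewrite !indicE; congr (_ * (_ : bool)%:R); apply/idP/idP; rewrite !inE/= in_itv.
  + by apply: measurable_funM => //; exact: measurable_indic.
  + move=> x; rewrite normrM indicE; case: (_ \in _); rewrite ?normr1 ?mulr1//.
    by rewrite normr0 mulr0 (le_trans _ (tb 0)).
Qed.

Lemma gaussian_max_upper {d : measure_display} {T : measurableType d} {R : realType}
    (P : probability T R) (I : finType) (A : {set I}) (U : I -> T -> R) (t : R) :
  (forall i, i \in A -> gaussian P (U i) 1) ->
  (P [set w | exists2 i, i \in A & (t < U i w)%R] <= (#|A|%:R * (1 - Phi t))%:E)%E.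
Proof.
move=> gU.
have mi : measurable_fun setT (\1_(`]t, +oo[%classic : set R) : R -> R).
  exact: measurable_indic.
have i1 x : `|\1_(`]t, +oo[%classic : set R) x| <= 1 :> R.
  by rewrite indicE; case: (_ \in _); rewrite ?normr1 ?normr0.
have iU i : i \in A -> intble P (fun w => \1_(`]t, +oo[%classic : set R) (U i w)).
  move=> iA; apply: (@intble_bounded _ _ _ P _ 1) => //.
  exact: measurableT_comp mi (gU i iA).1.
apply: (@le_trans _ _ (\int[P]_w \sum_(i in A) \1_(`]t, +oo[%classic : set R) (U i w))%:E).
  apply: prob_le_Rintegral.
  - rewrite (_ : [set _ | _] = \bigcup_(i in [set` A]) (U i @^-1` `]t, +oo[)).
      apply: fin_bigcup_measurable => [|i iA]; first exact: finite_finset.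
      by rewrite -[X in measurable X]setTI; apply: (gU i iA).1.
    by apply/seteqP; split => w /= [i iA]; rewrite /= ?in_itv/= ?andbT => h; exists i;
      rewrite //= in_itv/= andbT.
  - exact: intble_sum.
  - by move=> w; apply: sumr_ge0 => i _; rewrite indicE.
  - move=> w /= [i iA tU]; rewrite (bigD1 i)//= indicE mem_set/= ?in_itv/= ?tU//.
    by rewrite lerDl sumr_ge0// => j _; rewrite indicE.
rewrite lee_fin Rintegral_sum// (eq_bigr (fun=> 1 - Phi t)); last first.
  move=> i iA; rewrite (Rintegral_std (gU i iA) mi i1).
  by rewrite /Rintegral -tail_integral.
by rewrite big_const iter_addr_0 mulr_natl.
Qed.

(** Stein's identity for the constant function 1. *)
Lemma gaussian_mean {d : measure_display} {T : measurableType d} {R : realType}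
    (P : probability T R) (W : T -> R) (s : R) : gaussian P W s -> \int[P]_w W w = 0.
Proof.
move=> gW.
have i1 : intble (@normal_prob R 0 1) (fun x => x).
  apply: intble_le (intble_quartic R) _; first exact: measurable_id.
  by move=> x; have := normr_ge0 x; move: `|x| => y; nra.
rewrite (Rintegral_gaussian gW (g := idfun)); last 2 first.
- exact: measurable_id.
- exact: intbleZ.
rewrite RintegralZl//.
transitivity (s * \int[@normal_prob R 0 1]_x (x * cst 1 x)).
  by congr (_ * _); apply: eq_Rintegral => x _; rewrite mulr1.
rewrite (@stein_cubic _ (cst 1) (cst 0) 1).
- by rewrite (@Rintegral_prob_cst _ _ _ (@normal_prob R 0 1)) mulr0.
- exact: cst_continuous.
- by move=> x; rewrite normr1 exprn_ege1// lerDl.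
- by move=> x; rewrite normr0 mul1r exprn_ge0// addr_ge0.
Qed.

Lemma has_law_gaussian {d : measure_display} {T : measurableType d} {R : realType}
    (P : probability T R) (Z : {RV P >-> R}) (m s : R) : 0 <= s ->
  has_law P Z (normal_law m s) -> gaussian P (fun w => Z w - m) s.
Proof.
move=> s0 lZ; split; first exact: measurable_funB.
move=> A mA; have mB : measurable ((fun x : R => x - m) @^-1` A).
  by rewrite -[X in measurable X]setTI; apply: measurable_funB.
have := lZ _ mB; rewrite normal_law_affine// /distribution /pushforward/= => ->.
by congr normal_prob; apply/funext => x /=; rewrite addrAC subrr add0r.
Qed.

(** * The one-factor decomposition *)

Section equicorrelated.
Context {d : measure_display} {T : measurableType d} {R : realType}.
Variables (P : probability T R) (rho : R) (mu : nat -> R) (X : nat -> {RV P >-> R}).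
Hypotheses (gaussX : jointly_gaussian P X)
  (lawX : forall i, has_law P (X i) (normal_prob (mu i) 1))
  (corrX : forall i j : nat, i != j -> correlation P (X i) (X j) = rho).

Definition centered (i : nat) (w : T) : R := X i w - mu i.

Definition lincomb (n : nat) (a : nat -> R) (w : T) : R :=
  \sum_(i < n) a i * centered i w.

Lemma gaussian_centered i : gaussian P (centered i) 1.
Proof.
apply: has_law_gaussian => //; have := lawX i; rewrite /normal_law.
by rewrite (negbTE (oner_neq0 _)).
Qed.

Let intc i : intble P (centered i).
Proof.
have := intble_gaussian_exp (gaussian_centered i) (isT : (1 <= 4)%N).
by apply: eq_integrable => // w _; rewrite /= expr1.
Qed.

Let intc2 i : intble P (fun w => centered i w ^+ 2).
Proof. exact: (intble_gaussian_exp (gaussian_centered i) (isT : (2 <= 4)%N)). Qed.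

Let mc i : measurable_fun setT (centered i) := (gaussian_centered i).1.

Lemma mean_X i : fine 'E_P[X i] = mu i.
Proof.
rewrite unlock -[RHS]add0r -(gaussian_mean (gaussian_centered i)).
rewrite -[X in _ = _ + X](Rintegral_prob_cst P) -RintegralD//; last exact: intble_cst.
by apply: eq_Rintegral => w _; rewrite /centered subrK.
Qed.

Lemma covariance_X i j : fine (covariance P (X i) (X j)) = \int[P]_w (centered i w * centered j w).
Proof.
by rewrite covariance.unlock !mean_X unlock.
Qed.

Lemma centered_M i j : \int[P]_w (centered i w * centered j w) = if i == j then 1 else rho.
Proof.
have V k : \int[P]_w (centered k w * centered k w) = 1.
  under eq_Rintegral do rewrite -expr2.
  by rewrite (gaussian_exp2 (gaussian_centered k)) expr1n.
case: eqP => [->//|/eqP ij]; have := corrX ij.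
rewrite /correlation /variance !covariance_X !V sqrtr1 mulr1 divr1//.
Qed.

(** Joint Gaussianity provides parameters [m] and [s] without naming them. The mean identifies [m],
    so that centring removes it, and the second moment, expanded through the pairwise correlations,
    identifies [s]. *)
Lemma lincomb_gaussian n (a : nat -> R) : gaussian P (lincomb n a)
  (Num.sqrt ((1 - rho) * (\sum_(i < n) a i ^+ 2) + rho * (\sum_(i < n) a i) ^+ 2)).
Proof.
have [m [s [s0 lZ]]] := gaussX (fun i : 'I_n => a i).
have gZ := has_law_gaussian s0 lZ.
have ZE w : (\sum_(i < n) a i *: (X i : {mfun T >-> R})) w = \sum_(i < n) a i * X i w.
  by elim/big_ind2 : _ => // [f x g y /= <- <-].
have ilin : intble P (lincomb n a) by apply: intble_sum => i _; exact: intbleZ.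
have lin0 : \int[P]_w lincomb n a w = 0.
  rewrite Rintegral_sum; last by move=> i _; exact: intbleZ.
  by rewrite big1// => i _; rewrite RintegralZl// (gaussian_mean (gaussian_centered i)) mulr0.
have linE w : (\sum_(i < n) a i *: (X i : {mfun T >-> R})) w - m =
    lincomb n a w + (\sum_(i < n) a i * mu i - m).
  rewrite ZE addrA; congr (_ - _); rewrite /lincomb -big_split/=; apply: eq_bigr => i _.
  by rewrite /centered; ring.
rewrite (funext linE) in gZ.
have mE : \sum_(i < n) a i * mu i - m = 0.
  have := gaussian_mean gZ; rewrite RintegralD//; last exact: intble_cst.
  by rewrite lin0 Rintegral_prob_cst add0r.
have {}gZ : gaussian P (lincomb n a) s.
  by move: gZ; congr (gaussian P _ s); apply/funext => w; rewrite mE addr0.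
rewrite (_ : _ + _ = s ^+ 2) ?sqrtr_sqr ?ger0_norm//.
rewrite -(gaussian_exp2 gZ).
transitivity (\int[P]_w (\sum_(i < n) \sum_(j < n) (a i * a j) * (centered i w * centered j w))); last first.
  apply: eq_Rintegral => w _; rewrite expr2 mulr_suml; apply: eq_bigr => i _.
  by rewrite mulr_sumr; apply: eq_bigr => j _; ring.
have iM i j : intble P (fun w => centered i w * centered j w) by exact: intbleM.
rewrite Rintegral_sum; last by move=> i _; apply: intble_sum => j _; exact: intbleZ.
transitivity (\sum_(i < n) ((1 - rho) * a i ^+ 2 + rho * (a i * \sum_(j < n) a j))).
  by rewrite big_split/= -!mulr_sumr -mulr_suml expr2.
apply: eq_bigr => i _; rewrite Rintegral_sum; last by move=> j _; exact: intbleZ.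
under [RHS]eq_bigr do rewrite RintegralZl// centered_M.
rewrite mulr_sumr (bigD1 i)//= [in RHS](bigD1 i)//= eqxx mulr1.
rewrite mulrDr mulr_sumr addrA; congr (_ + _); first by ring.
apply: eq_bigr => j ji; rewrite ifN; first by ring.
by rewrite eq_sym.
Qed.

End equicorrelated.

(* The covariance of the linear combinations with coefficients a and b. *)
Definition equicov {R : realType} (rho : R) (n : nat) (a b : nat -> R) : R :=
  (1 - rho) * (\sum_(i < n) a i * b i) + rho * ((\sum_(i < n) a i) * (\sum_(i < n) b i)).

Section equicov.
Context {R : realType}.
Variables (rho : R) (n : nat).
Implicit Types (a b : nat -> R) (x y : R).

Lemma equicovDl a a' b :
  equicov rho n (fun l => a l + a' l) b = equicov rho n a b + equicov rho n a' b.
Proof.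
rewrite /equicov; under eq_bigr do rewrite mulrDl.
by rewrite !big_split/=; ring.
Qed.

Lemma equicovZl x a b : equicov rho n (fun l => x * a l) b = x * equicov rho n a b.
Proof.
rewrite /equicov; under eq_bigr do rewrite -mulrA.
by rewrite -!mulr_sumr; ring.
Qed.

Lemma equicovC a b : equicov rho n a b = equicov rho n b a.
Proof.
rewrite /equicov; under eq_bigr do rewrite mulrC.
by rewrite [X in rho * X]mulrC.
Qed.

Lemma equicov_delta (i j : nat) : (i < n)%N -> (j < n)%N ->
  equicov rho n (fun l => (l == i)%:R) (fun l => (l == j)%:R) =
  (1 - rho) * (i == j)%:R + rho.
Proof.
move=> iltn jn.
have sd (p : nat) (f : nat -> R) : (p < n)%N -> \sum_(l < n) (l == p :> nat)%:R * f l = f p.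
  move=> pn; rewrite (bigD1 (Ordinal pn))//= eqxx mul1r big1 ?addr0// => l lp.
  by rewrite -val_eqE/= in lp; rewrite (negbTE lp) mul0r.
have s1 (p : nat) : (p < n)%N -> \sum_(l < n) (l == p :> nat)%:R = 1 :> R.
  by move=> pn; rewrite -[RHS](sd p (fun=> 1))//; apply: eq_bigr => l _; rewrite mulr1.
rewrite /equicov (sd i (fun l => (l == j)%:R))// !s1//; ring.
Qed.

Lemma equicov_cst_delta x (i : nat) : (i < n)%N ->
  equicov rho n (fun=> x) (fun l => (l == i)%:R) = x * ((1 - rho) + rho * n%:R).
Proof.
move=> iltn; have s1 : \sum_(l < n) (l == i :> nat)%:R = 1 :> R.
  rewrite (bigD1 (Ordinal iltn))//= eqxx big1 ?addr0// => l lp.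
  by rewrite -val_eqE/= in lp; rewrite (negbTE lp).
rewrite /equicov -mulr_sumr s1 big_const iter_addr_0 card_ord -mulr_natr; ring.
Qed.

Lemma equicov_cst x y :
  equicov rho n (fun=> x) (fun=> y) = x * y * n%:R * ((1 - rho) + rho * n%:R).
Proof.
rewrite /equicov !big_const !iter_addr_0 !card_ord.
rewrite -(mulr_natr (x * y)) -(mulr_natr x) -(mulr_natr y); ring.
Qed.

End equicov.

Section equicorrelated_pairs.
Context {d : measure_display} {T : measurableType d} {R : realType}.
Variables (P : probability T R) (rho : R) (mu : nat -> R) (X : nat -> {RV P >-> R}).
Hypotheses (gaussX : jointly_gaussian P X)
  (lawX : forall i, has_law P (X i) (normal_prob (mu i) 1))
  (corrX : forall i j : nat, i != j -> correlation P (X i) (X j) = rho).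

Lemma lincomb_gaussian1 n (a : nat -> R) : equicov rho n a a = 1 ->
  gaussian P (lincomb mu X n a) 1.
Proof.
move=> aa; have := lincomb_gaussian gaussX lawX corrX n a.
by rewrite (_ : _ + _ = 1) ?sqrtr1// -[RHS]aa /equicov -expr2.
Qed.

Lemma lincombD n (a b : nat -> R) x y w :
  x * lincomb mu X n a w + y * lincomb mu X n b w =
  lincomb mu X n (fun l => x * a l + y * b l) w.
Proof.
rewrite /lincomb !mulr_sumr -big_split/=; apply: eq_bigr => i _; ring.
Qed.

(** By bilinearity the combination with weights x and y has variance x^2 + y^2, which is exactly
    what [std_pair] asks for. *)
Lemma lincomb_std_pair n (a b : nat -> R) :
  equicov rho n a a = 1 -> equicov rho n b b = 1 -> equicov rho n a b = 0 ->
  std_pair P (lincomb mu X n a) (lincomb mu X n b).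
Proof.
move=> aa bb ab x y.
rewrite (funext (fun w => lincombD n a b x y w)).
have := lincomb_gaussian gaussX lawX corrX n (fun l => x * a l + y * b l).
rewrite (_ : _ + _ = x ^+ 2 + y ^+ 2)//.
transitivity (equicov rho n (fun l => x * a l + y * b l) (fun l => x * a l + y * b l)).
  by rewrite /equicov -expr2; under [in RHS]eq_bigr do rewrite -expr2.
rewrite equicovDl !equicovZl (equicovC _ _ a) (equicovC _ _ b) !equicovDl !equicovZl.
by rewrite aa bb (equicovC _ _ b a) ab; ring.
Qed.

End equicorrelated_pairs.

(** * Whitening the centred vector *)

Section factor_model.
Context {d : measure_display} {T : measurableType d} {R : realType}.
Variables (P : probability T R) (rho : R) (mu : nat -> R) (X : nat -> {RV P >-> R}).
Hypotheses (rho01 : 0 < rho < 1) (gaussX : jointly_gaussian P X)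
  (lawX : forall i, has_law P (X i) (normal_prob (mu i) 1))
  (corrX : forall i j : nat, i != j -> correlation P (X i) (X j) = rho).
Variable n : nat.
Hypothesis n0 : (0 < n)%N.

Let s : R := (1 - rho) + rho * n%:R.
Let sigma : R := Num.sqrt (1 - rho).

(** The covariance matrix has eigenvalue 1 - rho + rho n on constant vectors and 1 - rho on their
    orthogonal complement; this is the ratio of the square roots of the second and the first. With
    it the residuals are the image of the centred vector under the inverse square root of the
    covariance matrix. *)
Definition shrink : R := Num.sqrt ((1 - rho) / (1 - rho + rho * n%:R)).
(** The part removed from each variable, (1 - shrink) times the average, in units of the
    standardized sum. *)
Definition loading : R := (1 - shrink) / n%:R * Num.sqrt (n%:R * (1 - rho + rho * n%:R)).

Definition factor : T -> R :=
  lincomb mu X n (fun=> (Num.sqrt (n%:R * (1 - rho + rho * n%:R)))^-1).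

(* Subtracting (1 - shrink) times the average, rather than the average itself,
   makes the residuals exactly uncorrelated. *)
Definition residual (i : nat) : T -> R := lincomb mu X n
  (fun l => (Num.sqrt (1 - rho))^-1 * ((l == i)%:R + - ((1 - shrink) / n%:R))).

Definition pair_diff (i : nat) : T -> R := lincomb mu X n
  (fun l => (Num.sqrt (2 * (1 - rho)))^-1 * ((l == i.*2)%:R + (-1) * (l == i.*2.+1)%:R)).

Let n0' : 0 < n%:R :> R. Proof. by rewrite ltr0n. Qed.
Let s0 : 0 < s.
Proof. by case/andP: rho01 => r0 r1; rewrite addr_gt0 ?subr_gt0// mulr_gt0. Qed.
Let r1 : 0 < 1 - rho. Proof. by case/andP: rho01; rewrite subr_gt0. Qed.
Let sigma0 : 0 < sigma. Proof. by rewrite sqrtr_gt0. Qed.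
Let sigma2 : sigma ^+ 2 = 1 - rho. Proof. by rewrite sqr_sqrtr// ltW. Qed.

Let shrink2 : shrink ^+ 2 = (1 - rho) / s.
Proof. by rewrite sqr_sqrtr// divr_ge0// ltW. Qed.

Let ns0 : 0 < Num.sqrt (n%:R * s). Proof. by rewrite sqrtr_gt0 mulr_gt0. Qed.

Lemma shrink_lt1 : shrink < 1.
Proof.
rewrite -[ltRHS]sqrtr1 ltr_sqrt// ltr_pdivrMr// mul1r ltrDl.
by case/andP: rho01 => ? _; rewrite mulr_gt0.
Qed.

Lemma loading_gt0 : 0 < loading.
Proof. by rewrite mulr_gt0// divr_gt0// subr_gt0 shrink_lt1. Qed.

Lemma factor_gaussian : gaussian P factor 1.
Proof.
apply: (lincomb_gaussian1 gaussX lawX corrX); rewrite equicov_cst -/s -expr2 exprVn.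
rewrite sqr_sqrtr; last by rewrite mulr_ge0 ?ltW.
by rewrite -mulrA mulVf// mulf_neq0// gt_eqF.
Qed.

Let residual_equicov i j : (i < n)%N -> (j < n)%N -> equicov rho n
  (fun l => sigma^-1 * ((l == i)%:R + - ((1 - shrink) / n%:R)))
  (fun l => sigma^-1 * ((l == j)%:R + - ((1 - shrink) / n%:R))) = (i == j)%:R.
Proof.
move=> iltn jn; set k := (1 - shrink) / n%:R.
rewrite equicovZl equicovDl (equicovC _ _ _ (fun l => sigma^-1 * _)).
rewrite [X in _ + X](equicovC _ _ _ (fun l => sigma^-1 * _)).
rewrite !equicovZl !equicovDl.
rewrite (equicovC _ _ (fun l => (l == j)%:R)) equicov_delta// !equicov_cst_delta//.
rewrite (equicovC _ _ (fun l => (l == j)%:R) (fun=> - k)) equicov_cst_delta// equicov_cst -/s.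
rewrite [LHS](_ : _ = (sigma ^+ 2)^-1 * ((1 - rho) * (i == j)%:R + rho + s * (k ^+ 2 * n%:R - 2 * k))); last first.
  by field; rewrite gt_eqF.
(* The choice of [shrink] makes the terms due to the subtracted average cancel [rho] exactly. *)
rewrite sigma2 (_ : s * _ = - rho); first by field; rewrite gt_eqF.
rewrite (_ : k ^+ 2 * n%:R - 2 * k = (shrink ^+ 2 - 1) / n%:R); last first.
  by rewrite /k; field; rewrite gt_eqF.
rewrite shrink2 /s; field.
by rewrite !gt_eqF.
Qed.

Lemma residual_gaussian i : (i < n)%N -> gaussian P (residual i) 1.
Proof. by move=> iltn; apply: (lincomb_gaussian1 gaussX lawX corrX); rewrite ?residual_equicov ?eqxx. Qed.

Lemma residual_std_pair i j : (i < n)%N -> (j < n)%N -> i != j ->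
  std_pair P (residual i) (residual j).
Proof.
move=> iltn jn ij; apply: (lincomb_std_pair gaussX lawX corrX); rewrite residual_equicov ?eqxx//.
by rewrite (negbTE ij).
Qed.

Let lincomb_delta i w : (i < n)%N -> lincomb mu X n (fun l => (l == i)%:R) w = centered mu X i w.
Proof.
move=> iltn; rewrite /lincomb (bigD1 (Ordinal iltn))//= eqxx mul1r big1 ?addr0// => l lp.
by rewrite -val_eqE/= in lp; rewrite (negbTE lp) mul0r.
Qed.

Lemma factor_decomposition i w : (i < n)%N ->
  X i w = mu i + sigma * residual i w + loading * factor w.
Proof.
move=> iltn; apply/eqP; rewrite -addrA addrC -subr_eq eq_sym; apply/eqP.
rewrite -/(centered mu X i w) -(lincomb_delta w iltn) lincombD; congr lincomb.
apply/funext => l; rewrite /loading -/s -/sigma; field.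
by rewrite !gt_eqF.
Qed.

Let pair_diff_equicov i j : (i.*2.+1 < n)%N -> (j.*2.+1 < n)%N -> equicov rho n
  (fun l => (Num.sqrt (2 * (1 - rho)))^-1 * ((l == i.*2)%:R + (-1) * (l == i.*2.+1)%:R))
  (fun l => (Num.sqrt (2 * (1 - rho)))^-1 * ((l == j.*2)%:R + (-1) * (l == j.*2.+1)%:R)) = (i == j)%:R.
Proof.
move=> iltn jn; set v : R := Num.sqrt _.
have v2 : v ^+ 2 = 2 * (1 - rho) by rewrite sqr_sqrtr// mulr_ge0// ltW.
have v0 : 0 < v by rewrite sqrtr_gt0 mulr_gt0.
have i2 := ltnW iltn; have j2 := ltnW jn.
rewrite equicovZl equicovDl equicovZl (equicovC _ _ _ (fun l => v^-1 * _)).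
rewrite [X in _ + _ * X](equicovC _ _ _ (fun l => v^-1 * _)).
rewrite !equicovZl !equicovDl !equicovZl !equicov_delta//.
have e1 : (j.*2 == i.*2) = (i == j) by rewrite eq_sym -!muln2 eqn_pmul2r.
have e2 : (j.*2.+1 == i.*2.+1) = (i == j) by rewrite eqSS.
have e3 : (j.*2 == i.*2.+1) = false by apply/negP => /eqP /(congr1 odd) /=; rewrite !odd_double.
have e4 : (j.*2.+1 == i.*2) = false by apply/negP => /eqP /(congr1 odd) /=; rewrite !odd_double.
rewrite e1 e2 e3 e4 (_ : false%:R = 0 :> R)//.
rewrite [LHS](_ : _ = (v ^+ 2)^-1 * (2 * (1 - rho) * (i == j)%:R)); last by field; rewrite gt_eqF.
by rewrite v2 mulKf// mulf_neq0// gt_eqF.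
Qed.

Lemma pair_diff_gaussian i : (i.*2.+1 < n)%N -> gaussian P (pair_diff i) 1.
Proof. by move=> iltn; apply: (lincomb_gaussian1 gaussX lawX corrX); rewrite ?pair_diff_equicov ?eqxx. Qed.

Lemma pair_diff_std_pair i j : (i.*2.+1 < n)%N -> (j.*2.+1 < n)%N -> i != j ->
  std_pair P (pair_diff i) (pair_diff j).
Proof.
move=> iltn jn ij; apply: (lincomb_std_pair gaussX lawX corrX); rewrite pair_diff_equicov ?eqxx//.
by rewrite (negbTE ij).
Qed.

Lemma pair_diff_decomposition i w : (i.*2.+1 < n)%N ->
  X i.*2 w - X i.*2.+1 w =
  (mu i.*2 - mu i.*2.+1) + Num.sqrt (2 * (1 - rho)) * pair_diff i w.
Proof.
move=> iltn; have i2 := ltnW iltn; set v : R := Num.sqrt _.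
have v0 : 0 < v by rewrite sqrtr_gt0 mulr_gt0.
transitivity (mu i.*2 - mu i.*2.+1 + (1 * centered mu X i.*2 w + (-1) * centered mu X i.*2.+1 w)).
  by rewrite /centered; ring.
congr (_ + _); rewrite -!lincomb_delta// lincombD /pair_diff /lincomb mulr_sumr.
by apply: eq_bigr => l _; rewrite -/v; field; rewrite gt_eqF.
Qed.

End factor_model.

(** * The correlation estimator *)

Section rho_hat_error.
Context {d : measure_display} {T : measurableType d} {R : realType}.
Variables (P : probability T R) (rho : R) (mu : nat -> R) (X : nat -> {RV P >-> R}).
Hypotheses (rho01 : 0 < rho < 1) (gaussX : jointly_gaussian P X)
  (lawX : forall i, has_law P (X i) (normal_prob (mu i) 1))
  (corrX : forall i j : nat, i != j -> correlation P (X i) (X j) = rho).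
Variable n : nat.
Hypothesis n2 : (1 < n)%N.

Let m := n./2.
Let theta i := mu i.*2 - mu i.*2.+1.
Let n0 : (0 < n)%N. Proof. exact: ltnW. Qed.

Let m0 : (0 < m)%N. Proof. by rewrite half_gt0. Qed.

Let pair_lt (i : 'I_m) : (i.*2.+1 < n)%N.
Proof.
have im := ltn_ord i; rewrite -(odd_double_half n) -/m.
by apply: (@leq_trans m.*2); rewrite ?leq_addl// -doubleS leq_double.
Qed.

Definition rho_tilde (w : T) : R :=
  (n./2)%:R^-1 * \sum_(i < n./2) (1 - (X i.*2 w - X i.*2.+1 w) ^+ 2 / 2).

Let mD (i : 'I_m) : measurable_fun setT (pair_diff rho mu X n i).
Proof. exact: (pair_diff_gaussian rho01 gaussX lawX corrX (pair_lt i)).1. Qed.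

Lemma measurable_rho_tilde : measurable_fun setT rho_tilde.
Proof.
apply: measurable_funM => //; apply: measurable_sum => i.
apply: measurable_funB => //; apply: measurable_funM => //; apply: measurable_funX.
exact: measurable_funB.
Qed.

(** Expanding each squared difference around its mean [theta i] separates a centred chi-square part,
    a part linear in the noise, and a deterministic bias. *)
Lemma rho_tilde_error (w : T) : rho_tilde w - rho =
  - m%:R^-1 * ((1 - rho) * (\sum_(i < m) 1 * (pair_diff rho mu X n i w ^+ 2 - 1)) +
     Num.sqrt (2 * (1 - rho)) * (\sum_(i < m) theta i * pair_diff rho mu X n i w) +
     (\sum_(i < m) theta i ^+ 2) / 2).
Proof.
have mN0 : m%:R != 0 :> R by rewrite pnatr_eq0 -lt0n.
have v2 : Num.sqrt (2 * (1 - rho)) ^+ 2 = 2 * (1 - rho).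
  by rewrite sqr_sqrtr// mulr_ge0// subr_ge0 ltW//; case/andP: rho01.
rewrite -[X in _ - X](mulKf mN0) -mulrBr mulNr -mulrN; congr (_ * _).
rewrite mulrC mulr_natr -{1}(card_ord m) -sumr_const -sumrB !mulr_sumr mulr_suml -!big_split/=.
rewrite -sumrN; apply: eq_bigr => i _.
rewrite (@pair_diff_decomposition _ _ _ P rho mu X rho01 n i w (pair_lt i)) -/(theta i).
rewrite sqrrD exprMn v2; by field.
Qed.

Let A w := \sum_(i < m) 1 * (pair_diff rho mu X n i w ^+ 2 - 1).
Let B w := \sum_(i < m) theta i * pair_diff rho mu X n i w.
Let S := \sum_(i < m) theta i ^+ 2.

Let gD (i : 'I_m) := pair_diff_gaussian rho01 gaussX lawX corrX (pair_lt i).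

Let DD (i j : 'I_m) (ij : i != j) : std_pair P (pair_diff rho mu X n i) (pair_diff rho mu X n j).
Proof. exact: pair_diff_std_pair. Qed.

Let intA2 : intble P (fun w => A w ^+ 2).
Proof.
have := @intble_sqr_sum _ _ _ P _ [set: 'I_m] (fun=> 1) (fun i w => pair_diff rho mu X n i w ^+ 2 - 1).
under eq_fun do under eq_bigl do rewrite inE.
apply => i _; last exact: intble_gaussian_sqr_variance.
by apply: measurable_funB => //; exact: measurable_funX.
Qed.

Let EA2 : \int[P]_w (A w ^+ 2) = m%:R * 2.
Proof.
have := @Rintegral_sqr_sum _ _ _ P _ [set: 'I_m] (fun=> 1) (fun i w => pair_diff rho mu X n i w ^+ 2 - 1).
under eq_fun do under eq_bigl do rewrite inE.
under [X in _ -> _ -> _ -> _ = X]eq_bigl do rewrite inE.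
move=> ->.
- rewrite (eq_bigr (fun=> 2)) ?sumr_const ?card_ord ?mulr_natl// => i _.
  by rewrite expr1n mul1r gaussian_sqr_variance.
- by move=> i _; apply: measurable_funB => //; exact: measurable_funX.
- by move=> i _; exact: intble_gaussian_sqr_variance.
- by move=> i j _ _ ij; apply: std_pair_sqrM; exact: DD.
Qed.

Let intB2 : intble P (fun w => B w ^+ 2).
Proof.
have := @intble_sqr_sum _ _ _ P _ [set: 'I_m] (fun i => theta i) (fun i w => pair_diff rho mu X n i w).
under eq_fun do under eq_bigl do rewrite inE.
by apply => i _ //; exact: (intble_gaussian_exp (gD i) (isT : (2 <= 4)%N)).
Qed.

Let EB2 : \int[P]_w (B w ^+ 2) = S.
Proof.
have := @Rintegral_sqr_sum _ _ _ P _ [set: 'I_m] (fun i => theta i) (fun i w => pair_diff rho mu X n i w).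
under eq_fun do under eq_bigl do rewrite inE.
under [X in _ -> _ -> _ -> _ = X]eq_bigl do rewrite inE.
move=> ->.
- by apply: eq_bigr => i _; rewrite (gaussian_exp2 (gD i)) expr1n mulr1.
- by [].
- by move=> i _; exact: (intble_gaussian_exp (gD i) (isT : (2 <= 4)%N)).
- by move=> i j _ _ ij; apply: std_pair_M; exact: DD.
Qed.

(** From (x + y + z)^2 <= 3 (x^2 + y^2 + z^2) and 1 - rho <= 1; the 1 / 4 is the square of the
    factor 1 / 2 in the bias. *)
Let bound w := m%:R^-1 ^+ 2 * (3 * (A w ^+ 2 + 2 * B w ^+ 2 + S ^+ 2 / 4)).

Let rho_tilde_le w : (rho_tilde w - rho) ^+ 2 <= bound w.
Proof.
have v2 : Num.sqrt (2 * (1 - rho)) ^+ 2 = 2 * (1 - rho).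
  by rewrite sqr_sqrtr// mulr_ge0// subr_ge0 ltW//; case/andP: rho01.
rewrite rho_tilde_error exprMn sqrrN ler_wpM2l ?sqr_ge0//.
rewrite -/(A w) -/(B w) -/S; move: (A w) (B w) S => a b s.
case/andP: rho01 => r0 r1; move: (Num.sqrt _) v2 => v v2.
apply: (@le_trans _ _ (3 * (((1 - rho) * a) ^+ 2 + (v * b) ^+ 2 + (s / 2) ^+ 2))).
  rewrite -subr_ge0; move: ((1 - rho) * a) (v * b) (s / 2) => x y z.
  rewrite [leRHS](_ : _ = (x - y) ^+ 2 + (y - z) ^+ 2 + (x - z) ^+ 2); last by ring.
  by rewrite !addr_ge0// sqr_ge0.
rewrite ler_pM2l// !exprMn v2 exprVn; apply: lerD; last by rewrite -natrX.
apply: lerD; first by rewrite ler_piMl ?sqr_ge0// expr_le1//; lra.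
by rewrite ler_wpM2r ?sqr_ge0//; lra.
Qed.

(** Chebyshev's inequality. The term 6 / m stems from the chi-square part, whose second moment is 2
    m, the term 6 S / m^2 from the linear part, whose second moment is S, and the last one from the
    bias. *)
Lemma rho_hat_prob (e b : R) : 0 < e -> 0 <= b ->
  (P [set w | (e < b * `|rho_hat X n w - rho|)%R] <=
   ((b / e) ^+ 2 * (6 / m%:R + 6 * S / m%:R ^+ 2 + (S / m%:R) ^+ 2))%:E)%E.
Proof.
move=> e0 b0.
have mhat : measurable_fun setT (rho_hat X n).
  by apply: measurable_maxr => //; exact: measurable_rho_tilde.
have ib : intble P bound.
  by apply/intbleZ/intbleZ/intbleD; [apply: intbleD => //; exact: intbleZ|exact: intble_cst].
(* Since rho > 0, truncation at 0 cannot increase the error. *)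
have hatE w : `|rho_hat X n w - rho| <= `|rho_tilde w - rho|.
  rewrite /rho_hat -/(rho_tilde w); case/andP: rho01 => r0 r1.
  case: (lerP 0 (rho_tilde w)) => // h.
  by rewrite sub0r normrN gtr0_norm// distrC ger0_norm; lra.
apply: (@le_trans _ _ (\int[P]_w ((b / e) ^+ 2 * bound w))%:E).
  apply: prob_le_Rintegral.
  - rewrite -[X in measurable X]setTI.
    rewrite (_ : [set w | _] = (fun w => b * `|rho_hat X n w - rho|) @^-1` `]e, +oo[); last first.
      by apply/seteqP; split => w /=; rewrite in_itv/= andbT.
    apply: measurable_funM => //; apply: measurableT_comp => //; exact: measurable_funB.
  - exact: intbleZ.
  - move=> w; rewrite mulr_ge0 ?sqr_ge0//.
    by apply: le_trans (rho_tilde_le w); exact: sqr_ge0.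
  - move=> w /= h; apply: (@le_trans _ _ ((b / e) ^+ 2 * (rho_tilde w - rho) ^+ 2)); last first.
      by rewrite ler_wpM2l ?sqr_ge0.
    rewrite -exprMn -real_normK ?num_real// exprn_ege1// normrM (ger0_norm (divr_ge0 b0 (ltW e0))).
    rewrite mulrAC ler_pdivlMr// mul1r; apply: (le_trans (ltW h)).
    by rewrite ler_wpM2l.
rewrite lee_fin RintegralZl// ler_wpM2l ?sqr_ge0//.
rewrite /bound !RintegralZl//; [|by apply: intbleD => //; [apply: intbleD => //; exact: intbleZ|exact: intble_cst]|by apply: intbleZ; apply: intbleD => //; [apply: intbleD => //; exact: intbleZ|exact: intble_cst]].
rewrite !RintegralD//; [|exact: intbleZ|by apply: intbleD => //; exact: intbleZ|exact: intble_cst].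
rewrite RintegralZl// EA2 EB2 Rintegral_prob_cst.
have mm : 0 < m%:R :> R by rewrite ltr0n.
rewrite [leLHS](_ : _ = 6 / m%:R + 6 * S / m%:R ^+ 2 + (3 / 4) * (S / m%:R) ^+ 2); last first.
  by field; rewrite gt_eqF.
by rewrite lerD2l ler_piMl ?sqr_ge0//; lra.
Qed.

End rho_hat_error.

(** * Perturbation of the cutoff *)

Lemma sqrt_dist (R : realType) (x y : R) : 0 <= x -> 0 < y ->
  `|Num.sqrt x - Num.sqrt y| <= `|x - y| / Num.sqrt y.
Proof.
move=> x0 y0; have sy : 0 < Num.sqrt y by rewrite sqrtr_gt0.
have E : x - y = (Num.sqrt x - Num.sqrt y) * (Num.sqrt x + Num.sqrt y).
  by rewrite -subr_sqr (sqr_sqrtr x0) (sqr_sqrtr (ltW y0)).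
rewrite ler_pdivlMr// E normrM.
rewrite ler_wpM2l// ger0_norm ?addr_ge0 ?sqrtr_ge0//.
by rewrite lerDr sqrtr_ge0.
Qed.

(** Both square roots are compared with their values at the interior points rho and 1 - rho, which
    bounds the difference quotients. The term in [Phi_inv alpha] is inflated by the quantile, which
    is at least 1, so that the whole bound is a multiple of the quantile times |r - rho|. *)
Lemma cutoff_dist (R : realType) (n : nat) (alpha rho r : R) :
  0 < rho < 1 -> 0 <= r <= 1 -> 1 <= Phi_inv (1 - n%:R^-1) :> R ->
  `|cutoff n alpha r - cutoff n alpha rho| <=
  Phi_inv (1 - n%:R^-1) * (1 / Num.sqrt (1 - rho) + `|Phi_inv alpha| / Num.sqrt rho) * `|r - rho|.
Proof.
move=> /andP[r0 r1] /andP[r0' r1'] b1; rewrite /cutoff.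
move: (Phi_inv alpha) (Phi_inv (1 - n%:R^-1)) b1 => q b b1.
rewrite [X in `|X|](_ : _ = (Num.sqrt (1 - r) - Num.sqrt (1 - rho)) * b -
   (Num.sqrt r - Num.sqrt rho) * q); last by ring.
rewrite (le_trans (ler_normB _ _))// !normrM.
rewrite (ger0_norm (le_trans ler01 b1)).
have h1 : `|Num.sqrt (1 - r) - Num.sqrt (1 - rho)| <= `|r - rho| / Num.sqrt (1 - rho).
  rewrite (le_trans (sqrt_dist _ _)) ?subr_ge0 ?subr_gt0//.
  by rewrite opprB addrCA addrAC subrr add0r distrC.
have h2 := @sqrt_dist R r rho r0' r0.
have c1 : 0 < (Num.sqrt (1 - rho))^-1 by rewrite invr_gt0 sqrtr_gt0 subr_gt0.
have c2 : 0 < (Num.sqrt rho)^-1 by rewrite invr_gt0 sqrtr_gt0.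
apply: (@le_trans _ _ (`|r - rho| / Num.sqrt (1 - rho) * b + `|r - rho| / Num.sqrt rho * `|q|)).
  apply: lerD; first by rewrite ler_wpM2r// (le_trans ler01).
  by rewrite ler_wpM2r.
rewrite [leRHS](_ : _ = `|r - rho| / Num.sqrt (1 - rho) * b + b * (`|r - rho| / Num.sqrt rho * `|q|)).
  by rewrite lerD2l ler_peMl// mulr_ge0// divr_ge0// sqrtr_ge0.
by rewrite div1r; ring.
Qed.

Lemma rho_hat_itv {T : Type} {R : realType} (X : nat -> T -> R) (n : nat) (w : T) :
  (1 < n)%N -> 0 <= rho_hat X n w <= 1.
Proof.
move=> n2; rewrite /rho_hat le_max lexx/= ge_max ler01/=.
have m0 : 0 < (n./2)%:R :> R by rewrite ltr0n half_gt0.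
rewrite mulrC ler_pdivrMr// mul1r -[leRHS](_ : \sum_(i < n./2) 1 = _); last first.
  by rewrite sumr_const card_ord.
by apply: ler_sum => i _; rewrite gerBl divr_ge0// sqr_ge0.
Qed.

(** * Rejection probability for a fixed number of hypotheses *)

Section fixed_n.
Context {d : measure_display} {T : measurableType d} {R : realType}.
Variables (P : probability T R) (rho alpha : R) (mu : nat -> R) (X : nat -> {RV P >-> R}).
Hypotheses (rho01 : 0 < rho < 1) (alpha01 : 0 < alpha < 1)
  (gaussX : jointly_gaussian P X)
  (lawX : forall i, has_law P (X i) (normal_prob (mu i) 1))
  (corrX : forall i j : nat, i != j -> correlation P (X i) (X j) = rho).
Variables (n : nat) (e : R).
Hypotheses (n2 : (1 < n)%N) (e0 : 0 < e).

Let b : R := Phi_inv (1 - n%:R^-1).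
Let q : R := Phi_inv alpha.
Let N := true_nulls mu n.
Let S : R := \sum_(i < n./2) (mu i.*2 - mu i.*2.+1) ^+ 2.
Let c : R := 1 / Num.sqrt (1 - rho) + `|q| / Num.sqrt rho.
Let m : R := (n./2)%:R.
Hypotheses (b1 : 1 <= b) (N0 : (0 < #|N|)%N).

Let rejection := [set w | exists2 i, i \in N & rejects X alpha n i w].

(* Bounds the probability that all residuals of true nulls are at most b - e:
   [gaussian_max_lower] with a = b - e / 2 and k = b ^+ 2. *)
Definition max_error : R :=
  4 * ((1 + b ^+ 2) / Num.sqrt (1 + 2 * b ^+ 2) *
       expR ((b - e / 2) ^+ 2 * (1 + b ^+ 2) / (1 + 2 * b ^+ 2)) / #|N|%:R) +
  2 * ((1 + b ^+ 2) * (e / 2) ^+ 2)^-1.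

(** Bounds the probability that b c |rho_hat - rho| exceeds e; outside this event the estimated
    cutoff is within e of the cutoff at [rho]. *)
Definition rho_error : R :=
  (b * c / e) ^+ 2 * (6 / m + 6 * S / m ^+ 2 + (S / m) ^+ 2).

Let U (i : 'I_n) := residual rho mu X n i.
Let Z := factor rho mu X n.
Let n0 : (0 < n)%N. Proof. exact: ltnW. Qed.
(** Exceptional events: outside [B1] and [B3] a rejection forces [Z] to be large, and outside [B2]
    and [B3] a large [Z] forces a rejection. *)
Let B1 := [set w | exists2 i, i \in N & b + e < U i w].
Let B2 := [set w | forall i, i \in N -> U i w <= b - e].
Let B3 := [set w | e < b * c * `|rho_hat X n w - rho|].

Let gU i : gaussian P (U i) 1.
Proof. exact: residual_gaussian. Qed.

Let gZ : gaussian P Z 1.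
Proof. exact: factor_gaussian. Qed.

Let mhat : measurable_fun setT (rho_hat X n).
Proof. by apply: measurable_maxr => //; exact: measurable_rho_tilde. Qed.

Let msetT (A : set T) : measurable (setT `&` A) -> measurable A.
Proof. by rewrite setTI. Qed.

Let mB1 : measurable B1.
Proof.
rewrite (_ : B1 = \bigcup_(i in [set` N]) (U i @^-1` `]b + e, +oo[)).
  apply: fin_bigcup_measurable => [|i iN]; first exact: finite_finset.
  by apply: msetT; apply: (gU i).1.
by apply/seteqP; split => w /= [i iN]; rewrite /= ?in_itv/= ?andbT => h; exists i;
  rewrite //= in_itv/= andbT.
Qed.

Let mB2 : measurable B2.
Proof.
rewrite (_ : B2 = \bigcap_(i in [set` N]) (U i @^-1` `]-oo, b - e])).
  apply: fin_bigcap_measurable => [|i iN]; first exact: finite_finset.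
  by apply: msetT; apply: (gU i).1.
by apply/seteqP; split => w /= h i iN; have := h i iN; rewrite /= in_itv.
Qed.

Let mB3 : measurable B3.
Proof.
apply: msetT; rewrite (_ : B3 = (fun w => b * c * `|rho_hat X n w - rho|) @^-1` `]e, +oo[); last first.
  by apply/seteqP; split => w /=; rewrite in_itv/= andbT.
apply: measurable_funM => //; apply: measurableT_comp => //; exact: measurable_funB.
Qed.

Let mcut : measurable_fun setT (fun w => cutoff n alpha (rho_hat X n w)).
Proof.
have msq : measurable_fun setT (@Num.sqrt R).
  by apply: continuous_measurable_fun; exact: sqrt_continuous.
apply: measurable_funB; apply: measurable_funM => //.
  by apply: (measurableT_comp msq); exact: measurable_funB.
exact: (measurableT_comp msq).
Qed.

Lemma measurable_rejection : measurable rejection.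
Proof.
rewrite (_ : rejection = \bigcup_(i in [set` N])
    ((fun w => X i w - cutoff n alpha (rho_hat X n w)) @^-1` `]0, +oo[)).
  apply: fin_bigcup_measurable => [|i iN]; first exact: finite_finset.
  by apply: msetT; apply: measurable_funB.
by apply/seteqP; split => w /= [i iN]; rewrite /rejects /= ?in_itv/= ?andbT ?subr_gt0 => h;
  exists i; rewrite //= in_itv/= andbT subr_gt0.
Qed.

Let PB1 : (P B1 <= (expR (- (e * b)))%:E)%E.
Proof.
have nR : 0 < n%:R :> R by rewrite ltr0n.
apply: (le_trans (gaussian_max_upper _ _)) => //; rewrite lee_fin.
have p01 : 0 < (1 - n%:R^-1 : R) < 1.
  by rewrite gtrBl invr_gt0 nR andbT subr_gt0 invf_lt1// ltr1n.
apply: (@le_trans _ _ (n%:R * (expR (- (e * b)) * n%:R^-1))); last first.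
  by rewrite mulrCA mulfV ?mulr1// gt_eqF.
apply: ler_pM => //.
- by rewrite -lee_fin -EFin_tail.
- by rewrite ler_nat -[leqRHS]card_ord max_card.
- apply: (le_trans (Phi_shift b (ltW e0))); rewrite ler_wpM2l ?expR_ge0//.
  by rewrite Phi_invK// opprB addrCA subrr addr0.
Qed.

Let PB2 : (P B2 <= max_error%:E)%E.
Proof.
have b0 : 0 < b ^+ 2 by rewrite exprn_gt0// (lt_le_trans ltr01).
have := @gaussian_max_lower _ _ _ P _ N U (b - e / 2) (b ^+ 2) (e / 2) b0 _ N0 (fun i _ => gU i).
rewrite divr_gt0// (_ : b - e / 2 - e / 2 = b - e); last by field.
by apply=> // i j _ _ ij; exact: residual_std_pair.
Qed.

Let PB3 : (P B3 <= rho_error%:E)%E.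
Proof.
apply: rho_hat_prob => //; apply: mulr_ge0; first exact: le_trans ler01 b1.
by rewrite addr_ge0// divr_ge0// sqrtr_ge0.
Qed.

Let tau := loading rho n.

Let PZ x : P [set w | x < tau * Z w] = (1 - Phi (x / tau))%:E.
Proof.
have t0 : 0 < tau by exact: loading_gt0.
rewrite -EFin_tail (_ : [set w | _] = Z @^-1` `](x / tau), +oo[).
  have m1 : measurable (`](x / tau), +oo[%classic : set R) by [].
  rewrite (gZ.2 _ m1); congr normal_prob; apply/funext => y /=; by rewrite mul1r.
by apply/seteqP; split => w /=; rewrite in_itv/= andbT ltr_pdivrMr// mulrC.
Qed.

Let mZ x : measurable [set w | x < tau * Z w].
Proof.
apply: msetT; rewrite (_ : [set w | _] = (fun w => tau * Z w) @^-1` `]x, +oo[); last first.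
  by apply/seteqP; split => w /=; rewrite in_itv/= andbT.
by apply: measurable_funM => //; exact: gZ.1.
Qed.

Let null_X (i : 'I_n) w : i \in N -> X i w = Num.sqrt (1 - rho) * U i w + tau * Z w.
Proof.
rewrite inE => /eqP mu0.
by rewrite (@factor_decomposition _ _ _ P rho mu X rho01 n n0 i w (ltn_ord i)) mu0 add0r.
Qed.

Let sigma01 : 0 <= Num.sqrt (1 - rho) <= 1.
Proof.
by rewrite sqrtr_ge0/= -[leRHS]sqrtr1 ler_wsqrtr// gerBl ltW//; case/andP: rho01.
Qed.

Let cutB3 w : ~ B3 w -> `|cutoff n alpha (rho_hat X n w) - cutoff n alpha rho| <= e.
Proof.
move=> /negP; rewrite -leNgt; apply: le_trans.
by apply: cutoff_dist => //; exact: rho_hat_itv.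
Qed.

Let union_bound (A C B B' : set T) (x y z : R) :
  measurable A -> measurable C -> measurable B -> measurable B' -> A `<=` C `|` (B `|` B') ->
  (P C <= x%:E)%E -> (P B <= y%:E)%E -> (P B' <= z%:E)%E -> (P A <= (x + (y + z))%:E)%E.
Proof.
move=> mA mC mB mB' ACB Cx By Bz.
have mBB := measurableU _ _ mB mB'.
apply: (le_trans (le_measure _ _ _ ACB)); rewrite ?inE//; first exact: measurableU.
apply: (le_trans (measureU2 _ mC mBB)); rewrite EFinD; apply: leeD => //.
by apply: (le_trans (measureU2 _ mB mB')); rewrite EFinD; exact: leeD.
Qed.

(** One [e] pays for the largest residual, whose coefficient sqrt (1 - rho) is at most 1, and the
    other for the estimated cutoff. The terms in the quantile cancel and leave a condition on
    [Z]. *)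
Lemma rejection_le : (P rejection <=
  (1 - Phi ((- (Num.sqrt rho * q) - 2 * e) / tau) + (expR (- (e * b)) + rho_error))%:E)%E.
Proof.
apply: (union_bound measurable_rejection (mZ (- (Num.sqrt rho * q) - 2 * e)) mB1 mB3) => //.
  2: by rewrite PZ.
move=> w /= [i iN rej].
have [B3w|nB3] := pselect (B3 w); first by right; right.
have [B1w|nB1] := pselect (B1 w); first by right; left.
left; have Ui : U i w <= b + e by rewrite leNgt; apply/negP => h; apply: nB1; exists i.
have := cutB3 nB3; move: rej; rewrite /rejects/= (null_X _ iN).
have : Num.sqrt (1 - rho) * U i w <= Num.sqrt (1 - rho) * b + e.
  apply: (@le_trans _ _ (Num.sqrt (1 - rho) * (b + e))).
    by case/andP: sigma01 => s0 _; rewrite ler_wpM2l.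
  by case/andP: sigma01 => s0 s1; rewrite mulrDr lerD2l ler_piMl// ltW.
rewrite [cutoff n alpha rho]/cutoff -/b -/q ler_norml; lra.
Qed.

Lemma rejection_ge : ((1 - Phi ((- (Num.sqrt rho * q) + 2 * e) / tau))%:E <=
  P rejection + (max_error + rho_error)%:E)%E.
Proof.
rewrite -PZ -[P rejection]fineK ?fin_num_measure//; last exact: measurable_rejection.
apply: (union_bound (mZ (- (Num.sqrt rho * q) + 2 * e)) measurable_rejection mB2 mB3) => //.
  2: by rewrite fineK// fin_num_measure//; exact: measurable_rejection.
move=> w /= hZ.
have [B3w|nB3] := pselect (B3 w); first by right; right.
have [B2w|nB2] := pselect (B2 w); first by right; left.
left; have [i [iN Ui]] : exists i, i \in N /\ b - e < U i w.
  move/existsNP : nB2 => [i /not_implyP[iN /negP Ui]]; exists i; split=> //.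
  by rewrite ltNge.
exists i => //; have := cutB3 nB3; rewrite /rejects/= (null_X _ iN).
have : Num.sqrt (1 - rho) * b - e <= Num.sqrt (1 - rho) * U i w.
  apply: (@le_trans _ _ (Num.sqrt (1 - rho) * (b - e))).
    by case/andP: sigma01 => s0 s1; rewrite mulrBr lerD2l lerN2 ler_piMl// ltW.
  by case/andP: sigma01 => s0 _; rewrite ler_wpM2l// ltW.
rewrite [cutoff n alpha rho]/cutoff -/b -/q ler_norml; lra.
Qed.

(** [Phi] is 1-Lipschitz and takes the value alpha at [q], so each one-sided bound costs the
    distance from its argument to [q]. *)
Lemma rejection_dist : `|fine (P rejection) - alpha| <=
  `|(Num.sqrt rho * q + 2 * e) / tau - q| + `|(Num.sqrt rho * q - 2 * e) / tau - q| +
  (expR (- (e * b)) + max_error + rho_error).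
Proof.
have qK : Phi q = alpha by exact: Phi_invK.
have lip (x y : R) : `|Phi x - Phi y| <= `|x - y|.
  have [xy|/ltW yx] := leP x y.
    rewrite distrC [leRHS]distrC !ger0_norm ?subr_ge0 ?Phi_le//; exact: Phi_lipschitz.
  by rewrite !ger0_norm ?subr_ge0 ?Phi_le//; exact: Phi_lipschitz.
have fP : P rejection \is a fin_num by rewrite fin_num_measure//; exact: measurable_rejection.
have up : fine (P rejection) <=
    Phi ((Num.sqrt rho * q + 2 * e) / tau) + (expR (- (e * b)) + rho_error).
  rewrite (_ : (Num.sqrt rho * q + 2 * e) / tau = - ((- (Num.sqrt rho * q) - 2 * e) / tau)); last by ring.
  by rewrite Phi_opp -lee_fin fineK//; exact: rejection_le.
have low : Phi ((Num.sqrt rho * q - 2 * e) / tau) <=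
    fine (P rejection) + (max_error + rho_error).
  rewrite (_ : (Num.sqrt rho * q - 2 * e) / tau = - ((- (Num.sqrt rho * q) + 2 * e) / tau)); last by ring.
  by rewrite Phi_opp -lee_fin [leRHS]EFinD fineK//; exact: rejection_ge.
have /ler_normlP := lip ((Num.sqrt rho * q + 2 * e) / tau) q.
have /ler_normlP := lip ((Num.sqrt rho * q - 2 * e) / tau) q.
have er : 0 <= rho_error by rewrite -lee_fin (le_trans _ PB3).
have em : 0 <= max_error by rewrite -lee_fin (le_trans _ PB2).
have ee := expR_ge0 (- (e * b)).
have := normr_ge0 ((Num.sqrt rho * q + 2 * e) / tau - q).
have := normr_ge0 ((Num.sqrt rho * q - 2 * e) / tau - q).
rewrite qK => a1 a2 [a3 a4] [a5 a6]; rewrite ler_norml; apply/andP; split; lra.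
Qed.

End fixed_n.

(** * Asymptotics *)

Section asymptotics.
Context {R : realType}.

Definition quant (n : nat) : R := Phi_inv (1 - n%:R^-1).

Lemma Phi_quant (n : nat) : (1 < n)%N -> Phi (quant n) = 1 - n%:R^-1.
Proof.
move=> n1; have n0 : 0 < n%:R :> R by rewrite ltr0n ltnW.
apply: Phi_invK; rewrite gtrBl invr_gt0 n0 andbT subr_gt0 invf_lt1// ltr1n//.
Qed.

Lemma quant_near (M : R) : \forall n \near \oo, M <= quant n.
Proof.
have h0 : 0 < 1 - Phi M.
  have : Phi M < Phi (M + 1) by apply: Phi_lt; rewrite ltrDl.
  have : 0 <= 1 - Phi (M + 1) by rewrite -lee_fin -EFin_tail.
  by lra.
(* Beyond the inverse of the tail at [M], 1 / n falls below that tail; the second successor also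
   ensures n > 1. *)
exists (Num.truncn (1 - Phi M)^-1).+2 => // n /= ln.
have n1 : (1 < n)%N by apply: leq_trans ln.
have n0 : 0 < n%:R :> R by rewrite ltr0n ltnW.
rewrite leNgt; apply/negP => /ltW/Phi_le; rewrite Phi_quant//; apply/negP; rewrite -ltNge.
have : (1 - Phi M)^-1 < n%:R.
  apply: (lt_le_trans (truncnS_gt _)); rewrite ler_nat; exact: ltnW.
rewrite invf_plt ?posrE//; lra.
Qed.

Lemma quant_expR (n : nat) : (1 < n)%N -> 0 <= quant n -> expR (quant n ^+ 2 / 2) <= n%:R.
Proof.
move=> n1 b0; have n0 : 0 < n%:R :> R by rewrite ltr0n ltnW.
have := Phi_chernoff b0; rewrite Phi_quant// opprB addrCA subrr addr0 expRN.
by rewrite lef_pV2 ?posrE ?expR_gt0.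
Qed.

Lemma quant_ln (n : nat) : (1 < n)%N -> 0 <= quant n -> quant n ^+ 2 <= 2 * ln n%:R.
Proof.
move=> n1 b0; have n0 : 0 < n%:R :> R by rewrite ltr0n ltnW.
have := quant_expR n1 b0; rewrite -{1}(@lnK R n%:R) ?posrE// ler_expR.
by rewrite ler_pdivrMr// mulrC.
Qed.

Lemma quantV_cvg : (quant n)^-1 @[n --> \oo] --> (0 : R).
Proof.
apply/cvgrPdist_le => e e0; near=> n.
have h : Num.max 1 e^-1 <= quant n by near: n; exact: quant_near.
have [h1 h2] : 1 <= quant n /\ e^-1 <= quant n by move: h; rewrite ge_max => /andP[].
have b0 : 0 < quant n by rewrite (lt_le_trans ltr01).
by rewrite sub0r normrN ger0_norm ?invr_ge0 ?(ltW b0)// invf_ple ?posrE.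
Unshelve. all: by end_near. Qed.

Lemma natV_cvg : n%:R^-1 @[n --> \oo] --> (0 : R).
Proof. by rewrite -cvg_shiftS; exact: cvg_harmonic. Qed.

Lemma loading_cvg (rho : R) : 0 < rho < 1 -> loading rho n @[n --> \oo] --> Num.sqrt rho.
Proof.
move=> /andP[r0 r1].
(* For n > 0, [loading rho n] is [f] at 1 / n, and [f] is continuous at 0. *)
pose f (h : R) := (1 - Num.sqrt ((1 - rho) * h / ((1 - rho) * h + rho))) * Num.sqrt ((1 - rho) * h + rho).
have f0 : f 0 = Num.sqrt rho by rewrite /f !mulr0 add0r mul0r sqrtr0 subr0 mul1r.
have cf : f h @[h --> (0 : R)] --> f 0.
  have c1 : (1 - rho) * h + rho @[h --> (0 : R)] --> (1 - rho) * 0 + rho.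
    by apply: cvgD; [apply: cvgM; [exact: cvg_cst|exact: cvg_id]|exact: cvg_cst].
  apply: cvgM; last by apply: continuous_cvg; [exact: sqrt_continuous|exact: c1].
  apply: cvgB; first exact: cvg_cst.
  apply: continuous_cvg; first exact: sqrt_continuous.
  apply: cvgM; first by apply: cvgM; [exact: cvg_cst|exact: cvg_id].
  by apply: cvgV => //; rewrite mulr0 add0r gt_eqF.
rewrite -f0; have := cvg_comp _ _ natV_cvg cf; apply: cvg_trans; apply: near_eq_cvg.
near=> n; have n0 : (0 < n)%N by near: n; exact: nbhs_infty_gt.
have nR : 0 < n%:R :> R by rewrite ltr0n.
have s0 : 0 < 1 - rho + rho * n%:R by rewrite addr_gt0 ?subr_gt0// mulr_gt0.
rewrite /f /loading /shrink /=.
have -> : (1 - rho) * n%:R^-1 + rho = (1 - rho + rho * n%:R) / n%:R.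
  by field; rewrite gt_eqF.
rewrite -[RHS]mulrA; congr (_ * _).
  by congr (1 - _); congr Num.sqrt; field; rewrite !gt_eqF.
rewrite (_ : (1 - rho + rho * n%:R) / n%:R = (n%:R^-1) ^+ 2 * (n%:R * (1 - rho + rho * n%:R))); last first.
  by field; rewrite gt_eqF.
by rewrite sqrtrM ?sqr_ge0// sqrtr_sqr ger0_norm// invr_ge0 ltW.
Unshelve. all: by end_near. Qed.

End asymptotics.

(** Write b for the quantile and a = b - e / 2. With k = b^2 the exponent exceeds a^2 / 2 = b^2 / 2
    - b e / 2 + e^2 / 8 by at most 1 / 4. Then exp(b^2 / 2) <= n cancels the number of true nulls,
    at least n / 2, while exp(- b e / 2) <= 48 / (b e)^3 beats the prefactor, at most 2 b^2; thus
    768 = 4 * 2 * 48 * 2. *)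
Lemma max_error_le (R : realType) (mu : nat -> R) (n : nat) (e : R) :
  (1 < n)%N -> 0 < e -> 1 <= quant n :> R -> e <= quant n ->
  n%:R / 2 <= (#|true_nulls mu n|%:R : R) ->
  max_error mu n e <=
    (768 / e ^+ 3 * expR (e ^+ 2 / 8 + 1 / 4) + 8 / e ^+ 2) / quant n.
Proof.
move=> n1 e0 b1 eb nN; rewrite /max_error -/(quant n).
have b0 := lt_le_trans ltr01 b1; have := quant_expR n1 (ltW b0).
move: (quant n) b1 b0 eb => b b1 b0 eb nb.
have n0 : 0 < n%:R :> R by rewrite ltr0n ltnW.
have N0 : 0 < #|true_nulls mu n|%:R :> R by rewrite (lt_le_trans _ nN)// divr_gt0.
set N : R := #|true_nulls mu n|%:R in nN N0 *.
have k0 : 0 < 1 + 2 * b ^+ 2 by rewrite addr_gt0// mulr_gt0// exprn_gt0.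
rewrite [leRHS]mulrDl; apply: lerD; last first.
  rewrite exprMn exprVn.
  apply: (@le_trans _ _ (8 / (e ^+ 2 * b ^+ 2))); last first.
    rewrite invfM mulrA ler_wpM2l ?divr_ge0 ?sqr_ge0// lef_pV2 ?posrE ?exprn_gt0//.
    by rewrite expr2 ler_peMl// ltW.
  rewrite [leRHS](_ : _ = 2 * (b ^+ 2 * (e ^+ 2 * 4^-1))^-1); last by field; rewrite !gt_eqF.
  rewrite ler_pM2l// -natrX lef_pV2 ?posrE ?mulr_gt0 ?exprn_gt0 ?addr_gt0 ?invr_gt0// ?exprn_gt0//.
  by rewrite ler_pM2r ?mulr_gt0 ?exprn_gt0 ?invr_gt0// lerDr.
have h1 : (1 + b ^+ 2) / Num.sqrt (1 + 2 * b ^+ 2) <= 2 * b ^+ 2.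
  rewrite ler_pdivrMr ?sqrtr_gt0//.
  apply: (@le_trans _ _ (2 * b ^+ 2 * 1)); first by rewrite mulr1; nra.
  rewrite ler_pM2l ?mulr_gt0 ?exprn_gt0// -[leLHS]sqrtr1 ler_wsqrtr//.
  by rewrite lerDl mulr_ge0// sqr_ge0.
have h2 : expR ((b - e / 2) ^+ 2 * (1 + b ^+ 2) / (1 + 2 * b ^+ 2)) <=
    expR (b ^+ 2 / 2) * (expR (- (b * e / 2)) * expR (e ^+ 2 / 8 + 1 / 4)).
  rewrite -!expRD ler_expR ler_pdivrMr//.
  have a2 : (b - e / 2) ^+ 2 <= b ^+ 2 by nra.
  rewrite -subr_ge0.
  rewrite [leRHS](_ : _ = (1 + 2 * b ^+ 2 - 2 * (b - e / 2) ^+ 2) / 4); last by field.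
  by rewrite divr_ge0//; lra.
have h3 : expR (- (b * e / 2)) <= 48 / (b ^+ 3 * e ^+ 3).
  have be : 0 < b * e / 2 by rewrite divr_gt0// mulr_gt0.
  rewrite expRN -[leRHS]invrK lef_pV2 ?posrE ?expR_gt0 ?invr_gt0 ?divr_gt0 ?mulr_gt0 ?exprn_gt0//.
  have := @expR_ge1Dxn R _ 2 (ltW be); apply: le_trans.
  rewrite (_ : 3`! = 6%N)// (_ : (_ / _)^-1 = (b * e / 2) ^+ 3 / 6%:R) ?lerDr//.
  by field; rewrite !gt_eqF.
have E0 := expR_ge0 (e ^+ 2 / 8 + 1 / 4).
have NV : N^-1 <= 2 / n%:R.
  by rewrite -[leRHS]invrK lef_pV2 ?posrE ?invr_gt0 ?divr_gt0// invf_div.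
apply: (@le_trans _ _ (4 * (2 * b ^+ 2 * (n%:R * (48 / (b ^+ 3 * e ^+ 3) * expR (e ^+ 2 / 8 + 1 / 4))) * (2 / n%:R)))); last first.
  rewrite le_eqVlt; apply/orP; left; apply/eqP; move: (expR _) => E; field.
  by rewrite !gt_eqF.
rewrite ler_pM2l//; apply: ler_pM => //; rewrite ?invr_ge0 ?(ltW N0)//.
  by rewrite mulr_ge0 ?expR_ge0// divr_ge0 ?addr_ge0 ?sqr_ge0 ?sqrtr_ge0.
apply: ler_pM => //; first by rewrite divr_ge0 ?addr_ge0 ?sqr_ge0 ?sqrtr_ge0.
apply: (le_trans h2); apply: ler_pM; rewrite ?expR_ge0 ?mulr_ge0 ?expR_ge0//.
by rewrite ler_wpM2r.
Qed.

(** * Consequences of the sparsity condition *)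

Section sparsity.
Context {R : realType}.
Variables (mu : nat -> R).
Hypothesis mu_ge0 : forall i, 0 <= mu i.

Definition signal (n : nat) : R := (n_false_nulls mu n)%:R * sup [set mu i ^+ 2 | i in `I_n].

Lemma sqr_le_sup n i : (i < n)%N -> mu i ^+ 2 <= sup [set mu i ^+ 2 | i in `I_n].
Proof.
move=> iltn; apply: ub_le_sup; last by exists i.
exists (\sum_(j < n) mu j ^+ 2) => _ [j /= jn <-].
by rewrite (bigD1 (Ordinal jn))//= lerDl sumr_ge0// => k _; exact: sqr_ge0.
Qed.

Lemma n_false_nullsE n : n_false_nulls mu n = #|~: true_nulls mu n|.
Proof. by rewrite [RHS]cardsCs finset.setCK card_ord. Qed.

(** For nonnegative x and y, (x - y)^2 <= x^2 + y^2. The pairs are disjoint, and only false nulls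
    contribute to the sum of squared means. *)
Lemma pair_sum_le_signal n :
  \sum_(i < n./2) (mu i.*2 - mu i.*2.+1) ^+ 2 <= signal n.
Proof.
apply: (@le_trans _ _ (\sum_(i < n) mu i ^+ 2)).
  apply: (@le_trans _ _ (\sum_(i < n./2) (mu i.*2 ^+ 2 + mu i.*2.+1 ^+ 2))).
    apply: ler_sum => i _; have := mu_ge0 i.*2; have := mu_ge0 i.*2.+1.
    by move: (mu _) (mu _) => x y; nra.
  have -> : \sum_(i < n./2) (mu i.*2 ^+ 2 + mu i.*2.+1 ^+ 2) = \sum_(0 <= i < n./2.*2) mu i ^+ 2.
    elim: n./2 => [|m IH]; first by rewrite big_ord0 big_geq.
    by rewrite big_ord_recr/= IH doubleS !big_nat_recr//= addrA.
  rewrite -(big_mkord predT (fun i => mu i ^+ 2)) [leRHS](@big_cat_nat _ _ _ n./2.*2)//=.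
    by rewrite lerDl sumr_ge0// => i _; exact: sqr_ge0.
  by rewrite -{2}(odd_double_half n) leq_addl.
rewrite (bigID (mem (true_nulls mu n)))/= big1 ?add0r; last first.
  by move=> i; rewrite inE => /eqP ->; rewrite expr0n.
rewrite /signal n_false_nullsE mulr_natl -sumr_const.
rewrite [leRHS](eq_bigl (fun i => i \notin true_nulls mu n)); last by move=> i; rewrite inE.
by apply: ler_sum => i _; exact: sqr_le_sup.
Qed.

(** Let b be the quantile and m = n./2, so that m >= n / 3. Then b^2 <= 2 ln n gives b^2 S / m <= 6
    x, which handles the linear part and the bias, while b^4 <= 8 n gives 6 b^2 / m <= 18 b^2 / n <=
    144 / b. *)
Lemma rho_error_le (rho alpha : R) (n : nat) (e : R) :
  let c := 1 / Num.sqrt (1 - rho) + `|Phi_inv alpha| / Num.sqrt rho in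
  let x := ln n%:R * signal n / n%:R in
  (1 < n)%N -> 0 < e -> 1 <= quant n :> R ->
  rho_error rho alpha mu n e <= (c / e) ^+ 2 * (144 / quant n + 36 * x + 36 * x ^+ 2).
Proof.
move=> c x n1 e0 b1; rewrite /rho_error -/(quant n) -/c.
have b0 := lt_le_trans ltr01 b1; have := quant_expR n1 (ltW b0).
have := quant_ln n1 (ltW b0).
move: (quant n) b1 b0 => b b1 b0 bL nb.
have n0 : 0 < n%:R :> R by rewrite ltr0n ltnW.
have m0 : 0 < (n./2)%:R :> R by rewrite ltr0n half_gt0.
have m1 : 1 <= (n./2)%:R :> R by rewrite ler1n half_gt0.
have nm : n%:R <= 3 * (n./2)%:R :> R.
  rewrite -natrM ler_nat -{1}(odd_double_half n) -muln2.
  have : (0 < n./2)%N by rewrite half_gt0.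
  by rewrite mulSn (mulnC 2) leq_add2r; apply: leq_trans; exact: leq_b1.
set S := \sum_(i < n./2) _; set m : R := (n./2)%:R in m0 m1 nm *.
have S0 : 0 <= S by apply: sumr_ge0 => i _; exact: sqr_ge0.
have SQ : S <= signal n := pair_sum_le_signal n.
have mV : m^-1 <= 3 / n%:R.
  by rewrite -[leRHS]invrK lef_pV2 ?posrE ?invr_gt0 ?divr_gt0// invf_div ler_pdivrMr// mulrC.
have x1 : b ^+ 2 * (S / m) <= 6 * x.
  apply: (@le_trans _ _ (2 * ln n%:R * (signal n * (3 / n%:R)))).
    by apply: ler_pM => //; rewrite ?sqr_ge0 ?divr_ge0 ?(ltW m0)//; apply: ler_pM; rewrite ?invr_ge0 ?(ltW m0).
  by rewrite /x le_eqVlt; apply/orP; left; apply/eqP; field; rewrite gt_eqF.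
have b4 : b ^+ 4 <= 8 * n%:R.
  have b20 : 0 <= b ^+ 2 / 2 by rewrite divr_ge0 ?sqr_ge0.
  have := @expR_ge1Dxn R _ 1 b20; rewrite (_ : 2`! = 2%N)// => h.
  have : (b ^+ 2 / 2) ^+ 2 / 2%:R <= n%:R by apply: le_trans nb; apply: le_trans h; rewrite lerDr.
  rewrite (_ : (b ^+ 2 / 2) ^+ 2 / 2%:R = b ^+ 4 / 8); last by field.
  by rewrite ler_pdivrMr// mulrC.
rewrite [leLHS](_ : _ = (c / e) ^+ 2 * (6 * (b ^+ 2 / m) + 6 * (b ^+ 2 * (S / m)) / m + (b ^+ 2 * (S / m)) ^+ 2 / b ^+ 2)); last first.
  by field; rewrite !gt_eqF.
rewrite ler_wpM2l ?sqr_ge0//.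
have y0 : 0 <= b ^+ 2 * (S / m) by rewrite mulr_ge0 ?sqr_ge0// divr_ge0// ltW.
apply: lerD; first apply: lerD.
- apply: (@le_trans _ _ (6 * (b ^+ 2 * (3 / n%:R)))); first by rewrite ler_pM2l// ler_wpM2l ?sqr_ge0.
  rewrite (_ : 6 * _ = 18 * b ^+ 2 / n%:R); last by field; rewrite gt_eqF.
  rewrite ler_pdivrMr// mulrAC ler_pdivlMr//.
  apply: (@le_trans _ _ (18 * b ^+ 4)); last by lra.
  by rewrite -mulrA -exprSr ler_pM2l// ler_weXn2l.
- apply: (@le_trans _ _ (6 * (b ^+ 2 * (S / m)))); last by lra.
  by rewrite ler_pdivrMr// ler_peMr// mulr_ge0.
- apply: (@le_trans _ _ ((b ^+ 2 * (S / m)) ^+ 2)).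
    by rewrite ler_pdivrMr ?exprn_gt0// ler_peMr ?sqr_ge0// exprn_ege1.
  by rewrite (_ : 36 * x ^+ 2 = (6 * x) ^+ 2) ?lerXn2r ?nnegrE// ?(le_trans y0)//; ring.
Qed.

End sparsity.

(** The means do not depend on n: a single nonzero mean eventually keeps the supremum bounded below,
    so the sparsity condition forces the fraction of false nulls below one half. If all means
    vanish, every hypothesis is a true null. *)
Lemma half_true_nulls (R : realType) (mu : nat -> R) :
  (forall i, 0 <= mu i) ->
  ln n%:R * signal mu n / n%:R @[n --> \oo] --> (0 : R) ->
  \forall n \near \oo, n%:R / 2 <= (#|true_nulls mu n|%:R : R).
Proof.
move=> mu_ge0 sparse.
have [[i0 mui]|all0] := pselect (exists i, mu i != 0); last first.
  near=> n; rewrite (_ : true_nulls mu n = [set: 'I_n]%SET) ?cardsT ?card_ord.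
    by rewrite ler_pdivrMr// ler_peMr// ler1n.
  apply/setP => i; rewrite !inE; apply/negPn/negP => h; apply: all0; by exists i.
have mu0 : 0 < mu i0 ^+ 2 by rewrite exprn_even_gt0.
have m4 : 0 < mu i0 ^+ 2 / 4 by rewrite divr_gt0.
near=> n.
have n1 : (1 < n)%N by near: n; exact: nbhs_infty_gt.
have in0 : (i0 < n)%N by near: n; exact: nbhs_infty_gt.
have b1 : 1 <= quant n :> R by near: n; exact: quant_near.
(* Together with ln n >= 1 / 2, this threshold gives n_1 < n / 2. *)
have x4 : ln n%:R * signal mu n / n%:R < mu i0 ^+ 2 / 4.
  by near: n; exact: cvgr_lt sparse _ m4.
have n0 : 0 < n%:R :> R by rewrite ltr0n ltnW.
have lnn : 1 / 2 <= ln n%:R :> R.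
  have := quant_ln n1 (le_trans ler01 b1).
  have : 1 <= quant n ^+ 2 :> R by rewrite exprn_ege1.
  by lra.
have : 1 / 2 * ((n_false_nulls mu n)%:R * mu i0 ^+ 2) / n%:R < mu i0 ^+ 2 / 4.
  apply: le_lt_trans x4; rewrite ler_pM2r ?invr_gt0//.
  apply: ler_pM => //; first by rewrite mulr_ge0// ltW.
  by rewrite /signal ler_wpM2l//; exact: sqr_le_sup.
rewrite /n_false_nulls natrB; last by rewrite -[leqRHS]card_ord max_card.
rewrite ltr_pdivrMr//; move: (mu i0 ^+ 2) mu0 => s s0; move: (#|_|%:R) => N.
rewrite (_ : 1 / 2 * _ = s * ((n%:R - N) / 2)); last by field.
rewrite (_ : s / 4 * _ = s * (n%:R / 4)); last by field.
by rewrite ltr_pM2l//; lra.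
Unshelve. all: by end_near. Qed.

(** * The limit of the rejection probability *)

Lemma rejection_cvg {d : measure_display} {T : measurableType d} {R : realType}
    (P : probability T R) (rho alpha : R) (mu : nat -> R) (X : nat -> {RV P >-> R}) :
  0 < rho < 1 -> 0 < alpha < 1 -> jointly_gaussian P X ->
  (forall i, has_law P (X i) (normal_prob (mu i) 1)) -> (forall i, 0 <= mu i) ->
  (forall i j : nat, i != j -> correlation P (X i) (X j) = rho) ->
  ln n%:R * signal mu n / n%:R @[n --> \oo] --> (0 : R) ->
  P [set w | exists2 i, i \in true_nulls mu n & rejects X alpha n i w]
    @[n --> \oo] --> alpha%:E.
Proof.
move=> rho01 alpha01 gX lX mu0 cX sparse.
have [r0 r1] := andP rho01.
have s0 : 0 < Num.sqrt rho by rewrite sqrtr_gt0.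
have nN := half_true_nulls mu0 sparse.
have N0 : \forall n \near \oo, (0 < #|true_nulls mu n|)%N.
  near=> n; have : n%:R / 2 <= (#|true_nulls mu n|%:R : R) by near: n; exact: nN.
  rewrite -(ltr0n R); apply: lt_le_trans; rewrite divr_gt0// ltr0n.
  by near: n; exact: nbhs_infty_gt.
apply/fine_cvgP; split.
  near=> n; rewrite fin_num_measure//.
  have n1 : (1 < n)%N by near: n; exact: nbhs_infty_gt.
  exact: measurable_rejection.
apply/cvgrPdist_lt => eps eps0.
set q : R := Phi_inv alpha; set c : R := 1 / Num.sqrt (1 - rho) + `|q| / Num.sqrt rho.
(* With this margin the two terms containing [loading] tend to 2 e / sqrt rho each, together eps /
   2, and all others tend to 0. *)
pose e := eps * Num.sqrt rho / 8.
have e0 : 0 < e by rewrite divr_gt0// mulr_gt0.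
pose x n := ln n%:R * signal mu n / n%:R.
(* The summand 1 / e covers exp(- e b) <= 1 / (e b) for the quantile b; the rest is the constant of
   [max_error_le]. *)
pose K := 1 / e + (768 / e ^+ 3 * expR (e ^+ 2 / 8 + 1 / 4) + 8 / e ^+ 2).
pose u n := `|(Num.sqrt rho * q + 2 * e) / loading rho n - q| +
  `|(Num.sqrt rho * q - 2 * e) / loading rho n - q| +
  (K * (quant n)^-1 + (c / e) ^+ 2 * (144 * (quant n)^-1 + 36 * x n + 36 * (x n * x n))).
have uV : u n @[n --> \oo] --> eps / 2.
  have -> : eps / 2 = `|(Num.sqrt rho * q + 2 * e) / Num.sqrt rho - q| +
      `|(Num.sqrt rho * q - 2 * e) / Num.sqrt rho - q| +
      (K * 0 + (c / e) ^+ 2 * (144 * 0 + 36 * 0 + 36 * (0 * 0))).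
    rewrite !mulr0 !addr0 mulr0 addr0.
    rewrite (_ : _ / _ - q = 2 * e / Num.sqrt rho); last by field; rewrite gt_eqF.
    rewrite (_ : _ / _ - q = - (2 * e / Num.sqrt rho)); last by field; rewrite gt_eqF.
    rewrite normrN ger0_norm; last by rewrite divr_ge0 ?mulr_ge0 ?ltW.
    by rewrite /e; field; rewrite gt_eqF.
  have t_cvg (y : R) : `|y / loading rho n - q| @[n --> \oo] --> `|y / Num.sqrt rho - q|.
    apply: cvg_norm; apply: cvgB; last exact: cvg_cst.
    apply: cvgM; first exact: cvg_cst.
    by apply: cvgV; [rewrite gt_eqF|exact: loading_cvg].
  have b_cvg (y : R) : y * (quant n)^-1 @[n --> \oo] --> y * 0.
    by apply: cvgM; [exact: cvg_cst|exact: quantV_cvg].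
  apply: cvgD; first by apply: cvgD.
  apply: cvgD => //; apply: cvgM; first exact: cvg_cst.
  apply: cvgD; first apply: cvgD => //; apply: cvgM; try exact: cvg_cst.
    exact: sparse.
  by apply: cvgM; exact: sparse.
near=> n; rewrite distrC.
have n1 : (1 < n)%N by near: n; exact: nbhs_infty_gt.
have b1 : 1 <= quant n :> R by near: n; exact: quant_near.
have be : e <= quant n by near: n; exact: quant_near.
have b0 := lt_le_trans ltr01 b1.
apply: (@le_lt_trans _ _ (u n)); last first.
  by near: n; apply: cvgr_lt uV _ _; rewrite ltr_pdivrMr// ltr_pMr// ltr1n.
apply: (le_trans (rejection_dist rho01 alpha01 gX lX cX n1 e0 b1 _)).
  by near: n; exact: N0.
rewrite -/q lerD2l; apply: lerD; last first.
  exact: (rho_error_le mu0 rho alpha n1 e0 b1).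
rewrite /K mulrDl; apply: lerD; last first.
  by apply: max_error_le => //; near: n.
rewrite -/(quant n) expRN div1r -invfM lef_pV2 ?posrE ?mulr_gt0 ?expR_gt0//.
by apply: le_trans (expR_ge1Dx _); rewrite lerDr.
Unshelve. all: by end_near. Qed.

Theorem theorem3p4 (R : realType) (d : measure_display) (T : measurableType d)
    (P : probability T R) (rho alpha : R) (mu : nat -> R)
    (X : nat -> {RV P >-> R})
    (rho01 : 0 < rho < 1) (alpha01 : 0 < alpha < 1)
    (gaussX : jointly_gaussian P X)
    (lawX : forall i, has_law P (X i) (normal_prob (mu i) 1))
    (mu_ge0 : forall i, 0 <= mu i)
    (corrX : forall i j : nat, i != j -> correlation P (X i) (X j) = rho)
    (sparse : (ln n%:R * (n_false_nulls mu n)%:R *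
        sup [set mu i ^+ 2 | i in `I_n] / n%:R : R) @[n --> \oo] --> (0 : R)) :
  (FWER P mu n (rejects X alpha n) @[n --> \oo] --> alpha%:E) /\
  (P (\bigcup_(i in [set` true_nulls mu n])
        [set w | X i w > cutoff n alpha (rho_hat X n w)])
     @[n --> \oo] --> alpha%:E).
Proof.
(* The union over the true nulls unfolds to the event that defines [FWER], so one limit gives
   both. *)
suff FWER_cvg : FWER P mu n (rejects X alpha n) @[n --> \oo] --> alpha%:E by split.
apply: (@rejection_cvg _ _ _ P rho) => //.
by under eq_fun do rewrite /signal mulrA.
Qed.
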